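(* Let $G$ be a finite, connected graph and $r \geq 3$ an integer. Then the following are equivalent: (i) $G$ is $r$-locally chordal. (ii) The canonical graph-decomposition $\mathcal{H}_r(G)$ of $G$ which displays its $r$-global structure is into cliques.
   Context: Graphs are simple. A graph is chordal if every cycle of length at least four has a chord. A clique is a vertex set inducing a complete subgraph; a maximal clique is an inclusion-maximal one. $\Gamma(G)$ below denotes no object; $\mathrm{Aut}(G)$ is the automorphism group of $G$. **Balls and locally chordal graphs.** For an integer $r\ge 0$, the ball $B_G(v,r/2)$ is the subgraph of $G$ formed by the vertices at distance at most $r/2$ from $v$ and the edges $xy$ with $d_G(v,x)+d_G(v,y)+1\le r$. $G$ is $r$-locally chordal if $B_G(v,r/2)$ is chordal for every vertex $v$. **Coverings.** A covering of $G$ is a surjective graph homomorphism $p:\hat G\to G$ that restricts, for every vertex $\hat v$ of $\hat G$, to a bijection from the edges at $\hat v$ to the edges at $p(\hat v)$. Deck transformations of $p$ are the automorphisms $\gamma$ of $\hat G$ with $p=p\circ\gamma$; they form the group $\Gamma(p)$. The covering is normal if $\Gamma(p)$ acts transitively on each fibre $p^{-1}(v)$. It is $r/2$-ball-preserving if it restricts to an isomorphism $B_{\hat G}(\hat v,r/2)\to B_G(p(\hat v),r/2)$ for every vertex $\hat v$ of $\hat G$. The $r$-local covering $p_r:G_r\to G$ of a connected graph $G$ is the connected (normal) covering of $G$ whose characteristic subgroup is the $r$-local subgroup of the fundamental group $\pi_1(G,x_0)$, i.e. the subgroup generated by the closed walks that go along a walk $W$ from $x_0$, then once around a cycle of length at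 most $r$, then back along $W$. Equivalently, it is the universal $r/2$-ball-preserving covering: $p_r$ is $r/2$-ball-preserving, and for every connected $r/2$-ball-preserving covering $p:\hat G\to G$ there is a covering $q:G_r\to\hat G$ with $p_r=p\circ q$. $G_r$ is the $r$-local cover of $G$. **Separations.** A separation of a graph $G$ is an unordered pair $\{A,B\}$ with $A\cup B=V(G)$ and no edge between $A\setminus B$ and $B\setminus A$. Its separator is $A\cap B$, its order is $|A\cap B|$; a $k$-separation is one of order $k$. It is proper if $A\setminus B$ and $B\setminus A$ are non-empty. It is tight if each of $A\setminus B$ and $B\setminus A$ contains the vertex set of a component $C$ of $G-(A\cap B)$ with $N_G(C)=A\cap B$. Its orientations are $(A,B)$ and $(B,A)$. Write $(A,B)\le(C,D)$ if $A\subseteq C$ and $B\supseteq D$. Two separations are nested if they have comparable orientations, and otherwise they cross; a set of separations is nested if its elements are pairwise nested. A set $S$ of separations is point-finite if every vertex lies in the separators of only finitely many elements of $S$. It is $\Gamma$-invariant (for $\Gamma\le\mathrm{Aut}(G)$) if $\{\phi(A),\phi(B)\}\in S$ for all $\{A,B\}\in S$, $\phi\in\Gamma$. A separation $\{A,B\}$ distinguishes vertex sets $X,Y$ if, up to renaming sides, $X\subseteq A$ and $Y\subseteq B$, and it does so efficiently if it has minimum order among all such separations. **Tree-decompositions.** A tree-decomposition of $G$ is a pair $(T,\mathcal V)$ of a tree $T$ and a family $\mathcal V=(V_t)_{t\in V(T)}$ of vertex sets (bags) with $G=\bigcup_t G[V_t]$ and such that for every vertex $v$ the subgraph $T_v$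 of $T$ induced on $\{t:v\in V_t\}$ is connected. Each edge $f=t_1t_2$ of $T$ induces the separation $s^f=\{A_1^f,A_2^f\}$, where $A_i^f$ is the union of the bags $V_t$ over all $t$ in the component of $T-f$ containing $t_i$. For $\Gamma\le\mathrm{Aut}(G)$, $(T,\mathcal V)$ is $\Gamma$-canonical if there is an action of $\Gamma$ on $T$ with $V_{\phi\cdot t}=\phi(V_t)$ for all $t\in V(T)$, $\phi\in\Gamma$; canonical means $\mathrm{Aut}(G)$-canonical. $(T,\mathcal V)$ is into cliques if every bag is a clique of $G$. **$\mathcal T(N)$.** Let $N$ be a nested set of proper separations of a connected graph. $\mathcal T(N)=(T,\mathcal V)$ is the following standard construction. An orientation $O$ of $N$ contains exactly one orientation of each element of $N$; it is consistent if there are no $(A,B),(C,D)\in O$ with $\{A,B\}\ne\{C,D\}$ and $(B,A)\le(C,D)$. The nodes of $T$ are the sets $\sigma$ of $\le$-maximal elements of those consistent orientations $O$ of $N$ in which every element lies below a maximal element. The edges of $T$ correspond to the elements of $N$: $\{A,B\}$ joins the node containing $(A,B)$ to the node containing $(B,A)$. The bag of $\sigma$ is $\bigcap_{(A,B)\in\sigma}B$ (and is $V(G)$ if $\sigma=\emptyset$). If $N$ is point-finite, $\mathcal T(N)$ is a tree-decomposition with $f\mapsto s^f$ a bijection $E(T)\to N$, and it is $\Gamma$-canonical if $N$ is $\Gamma$-invariant. **Bottlenecks (treated as a black box).** For each $k\in\mathbb N$ the $k$-bottlenecks in a graph $G$ are certain sets of $k$-separations of $G$ (notion of Jacobs, Knappe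 and Kurkofka). The following known facts about this notion are to be taken as given; the statement may be read for any fixed notion with these properties. (B1) Every $k$-bottleneck is a non-empty set of $k$-separations, and automorphisms of $G$ map $k$-bottlenecks to $k$-bottlenecks. (B2) If $X,Y$ are distinct maximal cliques of a locally finite chordal graph such that the separations efficiently distinguishing $X$ and $Y$ have order $k<\min(|X|,|Y|)$, then the set of all these separations is a $k$-bottleneck. (B3) For locally finite, connected $G$, the following construction of $N(G)$ is well-defined (all numbers $x^k(s)$ are finite), every $N^k(G,\beta)$ is non-empty, and $N(G)$ and all $N^{<k}(G)$ are $\mathrm{Aut}(G)$-invariant nested sets of tight separations. **Construction of $N(G)$ and $\mathcal T(G)$.** Let $\mathcal B^k(G)$ be the set of all $k$-bottlenecks in $G$ and $S^k=\bigcup\mathcal B^k(G)$. For $s\in S^k$ let $x^k(s)$ be the number of elements of $S^k$ that $s$ crosses. Recursively in $k\in\mathbb N$, let $N^{<k}(G)=\bigcup_{j<k}N^j(G)$; for $\beta\in\mathcal B^k(G)$ let $N^k(G,\beta)$ consist of those $s\in\beta$ that are nested with all of $N^{<k}(G)$ and among these have minimal $x^k(s)$; and let $N^k(G)=\bigcup_{\beta\in\mathcal B^k(G)}N^k(G,\beta)$. Set $N(G)=\bigcup_{k}N^k(G)$ and $\mathcal T(G):=\mathcal T(N(G))$. **Graph-decompositions and $\mathcal H_r(G)$.** A graph-decomposition of $G$ is a pair $(H,\mathcal V)$ of a graph $H$ and a family $\mathcal V=(V_h)_{h\in V(H)}$ of vertex sets (bags) of $G$, with $G=\bigcup_h G[V_h]$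 up to choosing parts as spanning subgraphs of the $G[V_h]$, and such that for each vertex $v$ the subgraph of $H$ induced on $\{h:v\in V_h\}$ is connected. It is into cliques if every bag is a clique of $G$. Given a normal covering $p:\hat G\to G$ and a $\Gamma(p)$-canonical tree-decomposition $(T,(\hat V_t)_t)$ of $\hat G$, the graph-decomposition obtained from it by folding via $p$ has as model graph the orbit graph $H=T/\Gamma(p)$ and as bags $V_h=p(\hat V_t)$ for any node $t$ in the orbit $h$. For a finite connected graph $G$ and an integer $r>0$, $\mathcal T(G_r)=\mathcal T(N(G_r))$ is (a known fact, which makes the following well-defined) a canonical tree-decomposition of $G_r$; the canonical graph-decomposition $\mathcal H_r(G)$ of $G$ which displays its $r$-global structure is the one obtained from $\mathcal T(G_r)$ by folding via $p_r$. *)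

(* Defs.v *)
From mathcomp Require Import all_boot.
From mathcomp Require Import boolp classical_sets functions cardinality.

Set Implicit Arguments.
Unset Strict Implicit.
Unset Printing Implicit Defensive.

Local Open Scope classical_set_scope.
Local Open Scope card_scope.

Record graph := Graph {
  vertex :> Type;
  adj : vertex -> vertex -> Prop;
  adj_sym : forall x y, adj x y -> adj y x;
  adj_irrefl : forall x, ~ adj x x }.
Arguments adj {g} x y.

Definition neighbours (G : graph) (v : G) : set G := [set w | adj v w].

Definition locally_finite (G : graph) : Prop :=
  forall v : G, finite_set (neighbours v).

(* [walk x s y]: the sequence [x :: s] is a walk from [x] to [y]; its length
   is [size s]. *)
Fixpoint walk (G : graph) (x : G) (s : seq G) (y : G) : Prop :=
  match s with
  | [::] => x = y
  | z :: s' => adj x z /\ walk z s' y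
  end.

(* A connected graph is non-empty. *)
Definition connected (G : graph) : Prop :=
  inhabited G /\ forall x y : G, exists s, walk x s y.

Definition is_dist (G : graph) (x y : G) (n : nat) : Prop :=
  (exists2 s, walk x s y & size s = n) /\
  (forall s, walk x s y -> n <= size s).

Definition is_cycle (G : graph) (n : nat) (c : 'I_n -> G) : Prop :=
  [/\ 2 < n, injective c & forall i, adj (c i) (c (ordS i))].

Definition has_chord (G : graph) (n : nat) (c : 'I_n -> G) : Prop :=
  exists i j, [/\ adj (c i) (c j), j <> ordS i & i <> ordS j].

Definition chordal (G : graph) : Prop :=
  forall n (c : 'I_n -> G), 3 < n -> is_cycle c -> has_chord c.

Definition clique (G : graph) (K : set G) : Prop :=
  forall x y, K x -> K y -> x <> y -> adj x y.

Definition maximal_clique (G : graph) (K : set G) : Prop :=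
  clique K /\ forall K', clique K' -> K `<=` K' -> K' = K.

Section Induced.
Variables (G : graph) (S : set G).
Let iadj (x y : {v : G | S v}) := adj (sval x) (sval y).
Fact induced_sym x y : iadj x y -> iadj y x. Proof. exact: adj_sym. Qed.
Fact induced_irrefl x : ~ iadj x x. Proof. exact: adj_irrefl. Qed.
Definition induced : graph := Graph induced_sym induced_irrefl.
End Induced.

Definition is_tree (T : graph) : Prop :=
  connected T /\ forall n (c : 'I_n -> T), ~ is_cycle c.

(* [C] is the vertex set of a component of [G - X]. *)
Definition component (G : graph) (X C : set G) : Prop :=
  [/\ C `<=` ~` X, connected (induced C) &
      forall D, D `<=` ~` X -> connected (induced D) -> C `<=` D -> D = C].

Definition neighbourhood (G : graph) (C : set G) : set G :=
  [set v | ~ C v /\ exists2 u, C u & adj u v].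

Definition automorphism (G : graph) : set (G -> G) :=
  [set f | bijective f /\ forall x y, adj (f x) (f y) <-> adj x y].

Section Ball.
Variables (G : graph) (v : G) (r : nat).
Definition ball_vertices : set G :=
  [set x | exists2 n, is_dist v x n & n.*2 <= r].
Let badj (x y : {x : G | ball_vertices x}) :=
  adj (sval x) (sval y) /\
  exists m n, [/\ is_dist v (sval x) m, is_dist v (sval y) n & m + n + 1 <= r].
Fact ball_sym x y : badj x y -> badj y x.
Proof.
move=> [xy [m [n [xm yn mn]]]]; split; first exact: adj_sym.
by exists n, m; split => //; rewrite [n + m]addnC.
Qed.
Fact ball_irrefl x : ~ badj x x. Proof. by move=> [/adj_irrefl]. Qed.

(* The ball of radius [r / 2] around [v]; in general not an induced subgraph. *)
Definition ball : graph := Graph ball_sym ball_irrefl.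
End Ball.

Definition locally_chordal (r : nat) (G : graph) : Prop :=
  forall v : G, chordal (ball v r).

(* In a simple graph the edges at a vertex correspond to its neighbours, so
   that bijectivity on the edges at [v] is bijectivity on [neighbours v]. *)
Definition covering (H G : graph) (p : H -> G) : Prop :=
  [/\ set_surj [set: H] [set: G] p,
      forall x y, adj x y -> adj (p x) (p y) &
      forall v, set_bij (neighbours v) (neighbours (p v)) p].

Definition deck (H G : graph) (p : H -> G) : set (H -> H) :=
  [set f | automorphism f /\ forall x, p (f x) = p x].

(* The elements of the fundamental group at [x0] are the closed walks at [x0]
   up to inserting and deleting backtracks; [s] stands for the walk
   [x0 :: s]. *)
Inductive homotopic (G : graph) (x0 : G) : seq G -> seq G -> Prop :=
| homotopic_refl s : homotopic x0 s s
| homotopic_sym s t : homotopic x0 s t -> homotopic x0 t s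
| homotopic_trans s t u :
    homotopic x0 s t -> homotopic x0 t u -> homotopic x0 s u
| homotopic_backtrack s v t : adj (last x0 s) v ->
    homotopic x0 (s ++ t) (s ++ v :: last x0 s :: t).

Definition rev_walk (G : graph) (x : G) (s : seq G) : seq G :=
  rev (belast x s).

(* The closed walks at [x0] whose homotopy class lies in the [r]-local
   subgroup.  In the generators, [codom c] is the closed walk which starts at
   [y], the last vertex of [c], and goes once around [c]. *)
Inductive local_subgroup (G : graph) (r : nat) (x0 : G) : seq G -> Prop :=
| local_subgroup1 : local_subgroup r x0 [::]
| local_subgroup_gen W y n (c : 'I_n -> G) :
    walk x0 W y -> is_cycle c -> n <= r -> last y (codom c) = y ->
    local_subgroup r x0 (W ++ codom c ++ rev_walk x0 W)
| local_subgroupM s t :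
    local_subgroup r x0 s -> local_subgroup r x0 t ->
    local_subgroup r x0 (s ++ t)
| local_subgroupV s :
    local_subgroup r x0 s -> local_subgroup r x0 (rev_walk x0 s)
| local_subgroup_homotopic s t :
    homotopic x0 s t -> local_subgroup r x0 s -> local_subgroup r x0 t.

(* The closed walks at [p x] whose homotopy class lies in the image of the
   fundamental group of [H] at [x]. *)
Definition characteristic_subgroup (H G : graph) (p : H -> G) (x : H)
    (s : seq G) : Prop :=
  exists2 t, walk x t x & homotopic (p x) (map p t) s.

(* [p] is the [r]-local covering, which is unique up to isomorphism.  As the
   [r]-local subgroup is normal, the choice of [x] is immaterial. *)
Definition local_covering (r : nat) (H G : graph) (p : H -> G) : Prop :=
  [/\ connected H, covering p &
      exists x, forall s, walk (p x) s (p x) ->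
        (characteristic_subgroup p x s <-> local_subgroup r (p x) s)].

(* A separation is an unordered pair [[set A; B]] of vertex sets. *)
Definition osep (G : graph) : Type := (set G * set G)%type.
Definition usep (G : graph) : Type := set (set G).

Section Separations.
Variable G : graph.
Implicit Types (a b : osep G) (s t : usep G) (S : set (usep G)).

Definition unorient a : usep G := [set a.1; a.2].
Definition flip a : osep G := (a.2, a.1).

Definition separation s : Prop :=
  exists2 a, unorient a = s &
    a.1 `|` a.2 = setT /\
    forall x y, (a.1 `\` a.2) x -> (a.2 `\` a.1) y -> ~ adj x y.

(* The separator of [[set A; B]] is the intersection of [A] and [B]. *)
Definition separator s : set G := \bigcap_(A in s) A.

Definition has_order s (k : nat) : Prop := separator s #= `I_k.

Definition tight s : Prop :=
  separation s /\
  forall a, unorient a = s ->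
    exists C, [/\ component (separator s) C, C `<=` a.1 `\` a.2 &
                  neighbourhood C = separator s].

Definition ole a b : Prop := a.1 `<=` b.1 /\ b.2 `<=` a.2.

Definition nested s t : Prop :=
  exists a b, [/\ unorient a = s, unorient b = t & ole a b \/ ole b a].

Definition crosses s t : Prop := ~ nested s t.

Definition nested_set S : Prop := forall s t, S s -> S t -> nested s t.

Definition map_osep (f : G -> G) a : osep G := (f @` a.1, f @` a.2).
Definition map_usep (f : G -> G) s : usep G := [set f @` A | A in s].

Definition invariant_set (Gamma : set (G -> G)) S : Prop :=
  forall f s, Gamma f -> S s -> S (map_usep f s).

Definition distinguishes s (X Y : set G) : Prop :=
  separation s /\
  exists2 a, unorient a = s & X `<=` a.1 /\ Y `<=` a.2.

Definition efficiently_distinguishes s (X Y : set G) : Prop :=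
  distinguishes s X Y /\
  forall t, distinguishes t X Y -> separator s #<= separator t.

End Separations.

(* The data common to tree- and graph-decompositions, without their axioms. *)
Record decomposition (G : graph) := Decomposition {
  model : graph;
  bag : model -> set G }.
Arguments Decomposition {G} model bag.
Arguments bag {G} d t.

Definition into_cliques (G : graph) (D : decomposition G) : Prop :=
  forall t, clique (bag D t).

Definition tree_decomposition (G : graph) (D : decomposition G) : Prop :=
  [/\ is_tree (model D),
      forall v, exists t, bag D t v,
      forall u v, adj u v -> exists2 t, bag D t u & bag D t v &
      forall v, connected (induced [set t | bag D t v])].

Definition canonical_action (G : graph) (Gamma : set (G -> G))
    (D : decomposition G) (act : (G -> G) -> model D -> model D) : Prop :=
  [/\ forall f, Gamma f -> automorphism (act f),
      forall t, act idfun t = t,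
      forall f g, Gamma f -> Gamma g -> forall t, act (f \o g) t = act f (act g t) &
      forall f, Gamma f -> forall t, bag D (act f t) = f @` bag D t].

Definition canonical_decomposition (G : graph) (D : decomposition G) : Prop :=
  exists act, canonical_action (@automorphism G) (D := D) act.

Section TreeOfNestedSet.
Variables (G : graph) (N : set (usep G)).

Definition orientation (O : set (osep G)) : Prop :=
  (forall a, O a -> N (unorient a)) /\
  (forall s, N s -> exists! a, O a /\ unorient a = s).

Definition consistent (O : set (osep G)) : Prop :=
  forall a b, O a -> O b -> unorient a <> unorient b -> ~ ole (flip a) b.

Definition maximal_elements (O : set (osep G)) : set (osep G) :=
  [set a | O a /\ forall b, O b -> ole a b -> b = a].

Definition is_node (sigma : set (osep G)) : Prop :=
  exists O, [/\ orientation O, consistent O,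
    forall a, O a -> exists2 b, maximal_elements O b & ole a b &
    sigma = maximal_elements O].

Definition node : Type := {sigma | is_node sigma}.

(* [N] is meant to be a nested set of proper separations (tight ones are
   proper); then [t <> u] is automatic. *)
Let nadj (t u : node) : Prop :=
  t <> u /\
  exists a, [/\ N (unorient a), sval t a & sval u (flip a)].
Fact node_sym t u : nadj t u -> nadj u t.
Proof.
move=> [tu [[A B] [NAB ta ub]]]; split; first by move/esym.
by exists (B, A); split => //; rewrite /unorient /= setUC.
Qed.
Fact node_irrefl t : ~ nadj t t. Proof. by case. Qed.

Definition tree_of : decomposition G :=
  Decomposition (Graph node_sym node_irrefl)
    (fun t => \bigcap_(a in sval t) a.2).

(* The action of automorphisms on the nodes.  The second branch is not taken if
   [N] is invariant, see [is_node_map]. *)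
Definition tree_act (f : G -> G) (t : model tree_of) : model tree_of :=
  match pselect (is_node (map_osep f @` sval t)) with
  | left h => exist _ _ h
  | right _ => t
  end.

End TreeOfNestedSet.

Section NodeMap.
Variables (G : graph).
Implicit Types (f g : G -> G).

Lemma unorient_map f a : unorient (map_osep f a) = map_usep f (unorient a).
Proof. by rewrite /unorient /map_usep image_setU !image_set1. Qed.

Lemma map_osepK f g : cancel f g -> cancel (map_osep f) (map_osep g).
Proof.
move=> fK [A B]; rewrite /map_osep /= !image_comp.
by congr (_, _); rewrite -[RHS]image_id; apply: eq_imagel => x _ /=; exact: fK.
Qed.

Lemma map_usepK f g : cancel f g -> cancel (map_usep f) (map_usep g).
Proof.
move=> fK s; rewrite /map_usep image_comp -[RHS]image_id.
apply: eq_imagel => A _ /=; rewrite image_comp -[RHS]image_id.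
by apply: eq_imagel => x _ /=; exact: fK.
Qed.

Lemma ole_map f a b : ole a b -> ole (map_osep f a) (map_osep f b).
Proof. by move=> [ab ba]; split; exact: image_subset. Qed.

Lemma flip_map f a : flip (map_osep f a) = map_osep f (flip a).
Proof. by []. Qed.

Lemma is_node_map (N : set (usep G)) f sigma : automorphism f ->
  invariant_set (@automorphism G) N ->
  is_node N sigma -> is_node N (map_osep f @` sigma).
Proof.
move=> fA NI [O [[ON NO] Oc Om ->]].
have [[g fK gK] fadj] := fA.
have gA : automorphism g.
  by split=> [|x y]; [exists f | rewrite -fadj !gK].
have foK := map_osepK fK; have goK := map_osepK gK.
have fmax a : maximal_elements O a ->
    maximal_elements (map_osep f @` O) (map_osep f a).
  move=> [Oa amax]; split; first by exists a.
  move=> _ [b Ob <-] /(ole_map g); rewrite !foK => /amax -> //.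
have gmax a : maximal_elements (map_osep f @` O) a ->
    maximal_elements O (map_osep g a).
  move=> [[b Ob <-]] bmax; rewrite foK; split => // c Oc' /(ole_map f) bc.
  by apply: (can_inj foK); apply: bmax => //; exists c.
exists (map_osep f @` O); split.
- split=> [_ [a Oa <-]|s Ns].
    by rewrite unorient_map; apply: NI => //; exact: ON.
  have [a [[Oa ga] aU]] := NO _ (NI _ _ gA Ns).
  exists (map_osep f a); split.
    split; first by exists a.
    by rewrite unorient_map ga (map_usepK gK).
  move=> _ [[b Ob <-] bs]; rewrite (aU b) //; split => //.
  by rewrite -bs unorient_map (map_usepK fK).
- move=> _ _ [a Oa <-] [b Ob <-]; rewrite !unorient_map flip_map => ab.
  move=> /(ole_map g); rewrite !foK; apply: (Oc _ _ Oa Ob) => E.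
  by apply: ab; rewrite E.
- move=> _ [a Oa <-]; have [b bm ab] := Om _ Oa.
  by exists (map_osep f b); [exact: fmax | exact: ole_map].
- rewrite eqEsubset; split=> [_ [a am <-]|a am]; first exact: fmax.
  by exists (map_osep g a); [exact: gmax | exact: goK].
Qed.
End NodeMap.

Section Fold.
Variables (H G : graph) (p : H -> G) (D : decomposition H).
Variable act : (H -> H) -> model D -> model D.

Definition orbit (t : model D) : set (model D) := [set act f t | f in deck p].
Definition orbit_node : Type := {h | exists t, h = orbit t}.

(* Graphs are simple, so loops and parallel edges of the orbit graph are
   disregarded. *)
Let oadj (h k : orbit_node) : Prop :=
  h <> k /\ exists t u, [/\ sval h t, sval k u & adj t u].
Fact orbit_sym h k : oadj h k -> oadj k h.
Proof.
move=> [hk [t [u [ht ku tu]]]]; split; first by move/esym.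
by exists u, t; split => //; exact: adj_sym.
Qed.
Fact orbit_irrefl h : ~ oadj h h. Proof. by case. Qed.

(* [p @` bag D t] is the same for all nodes [t] of an orbit when [act] is a
   canonical action. *)
Definition orbit_repr (h : orbit_node) : model D := sval (cid (svalP h)).

Definition fold_decomposition : decomposition G :=
  Decomposition (Graph orbit_sym orbit_irrefl)
    (fun h => p @` bag D (orbit_repr h)).
End Fold.

(* [B G k] is the set of all [k]-bottlenecks in [G]. *)
Definition bottleneck_notion : Type :=
  forall G : graph, nat -> set (set (usep G)).

Section NestedSet.
Variables (B : bottleneck_notion) (G : graph).
Implicit Types (k : nat) (s t : usep G) (beta : set (usep G)).

Definition bottleneck_seps k : set (usep G) := \bigcup_(beta in @B G k) beta.

(* The number x^k(s) is the cardinality of this set. *)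
Definition crossing_seps k s : set (usep G) :=
  [set t | bottleneck_seps k t /\ crosses s t].

(* The elements of [beta] nested with all of [M] that have minimal x^k. *)
Definition N_step (M : set (usep G)) k beta : set (usep G) :=
  let E := [set s | beta s /\ forall t, M t -> nested s t] in
  [set s | E s /\ forall t, E t -> crossing_seps k s #<= crossing_seps k t].

Fixpoint N_lt k : set (usep G) :=
  match k with
  | 0 => set0
  | j.+1 => N_lt j `|` \bigcup_(beta in @B G j) N_step (N_lt j) j beta
  end.

Definition N_bottleneck k beta : set (usep G) := N_step (N_lt k) k beta.
Definition N_at k : set (usep G) := \bigcup_(beta in @B G k) N_bottleneck k beta.
Definition N_all : set (usep G) := \bigcup_k N_at k.

Definition bottleneck_tree : decomposition G := tree_of N_all.

Definition invariant_nested_tight (S : set (usep G)) : Prop :=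
  [/\ invariant_set (@automorphism G) S, nested_set S &
      forall s, S s -> tight s].
End NestedSet.

(* The known properties of bottlenecks which are taken for granted.  In
   [bottleneck_chordal] an efficiently distinguishing separation exists, since
   [[set setT; Y]] distinguishes [X] and [Y]. *)
Record bottleneck_axioms (B : bottleneck_notion) : Prop := BottleneckAxioms {
  bottleneck_nonempty : forall (G : graph) k beta, @B G k beta -> beta !=set0;
  bottleneck_sep : forall (G : graph) k beta (s : usep G), @B G k beta -> beta s ->
    separation s /\ has_order s k;
  bottleneck_aut : forall (G : graph) k beta f, automorphism f ->
    @B G k beta -> @B G k (map_usep f @` beta);
  bottleneck_chordal : forall (G : graph) (X Y : set G) (k m n : nat),
    locally_finite G -> chordal G ->
    maximal_clique X -> maximal_clique Y -> X <> Y ->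
    (forall s, efficiently_distinguishes s X Y -> has_order s k) ->
    X #= `I_m -> Y #= `I_n -> k < minn m n ->
    @B G k [set s | efficiently_distinguishes s X Y];
  crossing_finite : forall (G : graph) k (s : usep G),
    locally_finite G -> connected G ->
    bottleneck_seps B k s -> finite_set (crossing_seps B k s);
  N_bottleneck_nonempty : forall (G : graph) k beta,
    locally_finite G -> connected G ->
    @B G k beta -> N_bottleneck B k beta !=set0;
  N_lt_nested : forall (G : graph) k,
    locally_finite G -> connected G -> invariant_nested_tight (@N_lt B G k);
  N_all_nested : forall (G : graph),
    locally_finite G -> connected G -> invariant_nested_tight (@N_all B G);
  (* This makes the global decomposition below well-defined. *)
  local_cover_tree : forall (G H : graph) (r : nat) (p : H -> G),
    finite_set [set: G] -> connected G -> 0 < r -> local_covering r p ->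
    tree_decomposition (bottleneck_tree B H) /\
    canonical_decomposition (bottleneck_tree B H) }.

(* The graph-decomposition of [G] which displays its [r]-global structure,
   where [p : H -> G] is the [r]-local covering of [G]. *)
Definition global_decomposition (B : bottleneck_notion) (H G : graph)
    (p : H -> G) : decomposition G :=
  fold_decomposition p (@tree_act H (@N_all B H)).

(* Main.v *)
(* If [G] is [r]-locally chordal, then every cycle of length at most [r] is a
   sum of triangles, so a symmetric edge labelling of [Gr] by booleans that sums
   to zero on triangles sums to zero on all closed walks.  A hole of [Gr]
   through [a, v, b] is excluded by such a labelling: a clique [K] containing
   [v] which separates [a] from [b] in the link of [v] splits the edges leaving
   [K] into classes linked by triangles, and, as links are chordal, [va] and
   [vb] lie in different classes; the class of [va] meets the hole only once.
   Hence [Gr] is chordal, and for non-adjacent [x] and [y] the bottleneck of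
   suitable maximal cliques around [x] and [y] puts a separation into [N] that
   keeps [x] and [y] from sharing a bag.

   Conversely, let all projected bags be cliques.  A tight separator contained
   in a bag is a clique: otherwise a closed walk through both sides contradicts
   the labelling of the edges from one side to the closed neighbourhood of a
   vertex in the separator, which sums to zero on walks of length at most [r].
   Hence the bags of [Gr] are cliques, so [Gr] is chordal, and chordality
   descends to the balls of [G] because cycles in balls lift. *)
Require Import Defs.
From mathcomp Require Import all_boot zify.
From mathcomp Require Import boolp classical_sets functions cardinality.

Set Implicit Arguments.
Unset Strict Implicit.
Unset Printing Implicit Defensive.

Local Open Scope classical_set_scope.

(** * Walks *)

Lemma min_nat (P : nat -> Prop) n : P n ->
  exists2 m, P m & forall k, P k -> m <= k.
Proof.
move=> Pn; have ex : exists n, `[<P n>] by exists n; apply/asboolP.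
case: (ex_minnP ex) => m /asboolP Pm mmin; exists m => // k Pk.
by apply: mmin; apply/asboolP.
Qed.

Section Walks.
Variable G : graph.
Implicit Types (x y z : G) (s t : seq G).

Lemma walk_cat x y z s t : walk x s z -> walk z t y -> walk x (s ++ t) y.
Proof.
elim: s x => [|w s IH] x /=; first by move=> ->.
by move=> [xw ws] zt; split=> //; exact: IH.
Qed.

Lemma walk_last x y s : walk x s y -> last x s = y.
Proof. by elim: s x => [|z s IH] x //= [_ /IH]. Qed.

Lemma walk_rev x y s : walk x s y -> walk y (rev_walk x s) x.
Proof.
rewrite /rev_walk; elim: s x => [|z s IH] x //= [xz /IH zs].
rewrite rev_cons -cats1; apply: walk_cat zs _.
by split=> //; exact: adj_sym.
Qed.

Lemma size_rev_walk x s : size (rev_walk x s) = size s.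
Proof. by rewrite /rev_walk size_rev size_belast. Qed.

Lemma walk_take x y s i : i <= size s -> walk x s y ->
  walk x (take i s) (nth x (x :: s) i).
Proof.
elim: s x i => [|z s IH] x [|i] //= ils [xz zs]; split=> //.
by have := IH z i ils zs; rewrite (set_nth_default x) //= ltnS.
Qed.

Lemma walk_drop x y s i : i <= size s -> walk x s y ->
  walk (nth x (x :: s) i) (drop i s) y.
Proof.
elim: s x i => [|z s IH] x [|i] //= ils [xz zs].
by have := IH z i ils zs; rewrite (set_nth_default x) //= ltnS.
Qed.

Lemma walk_sub x y s i j : i <= j <= size s -> walk x s y ->
  walk (nth x (x :: s) i) (drop i (take j s)) (nth x (x :: s) j).
Proof.
move=> /andP[ij js] xs; have := walk_take js xs.
move=> /(@walk_drop _ _ _ i); rewrite size_takel // => /(_ ij).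
by congr walk; rewrite -[x :: take j s]/(take j.+1 (x :: s)) nth_take.
Qed.

Lemma walk_nth x y s i : i < size s -> walk x s y ->
  adj (nth x (x :: s) i) (nth x s i).
Proof.
elim: s x i => [|z s IH] x [|i] //= ils [xz zs] //.
have := IH z i ils zs; rewrite (set_nth_default x z ils).
by rewrite (@set_nth_default _ (z :: s) x z) // ltnW.
Qed.

Lemma nth_walk_size x y s : walk x s y -> nth x (x :: s) (size s) = y.
Proof. by move=> /walk_last <-; rewrite -[size s]/(size (x :: s)).-1 nth_last. Qed.

Lemma walk_cut x y s i j : i <= size s -> j <= size s ->
  nth x (x :: s) i = nth x (x :: s) j -> walk x s y ->
  walk x (take i s ++ drop j s) y.
Proof.
move=> il jl E xs; apply: walk_cat (walk_take il xs) _.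
by rewrite E; exact: walk_drop.
Qed.

Lemma walk_shortcut x y s i j : i <= size s -> j <= size s ->
  adj (nth x (x :: s) i) (nth x (x :: s) j) -> walk x s y ->
  walk x (take i s ++ nth x (x :: s) j :: drop j s) y.
Proof.
move=> il jl E xs; apply: walk_cat (walk_take il xs) _.
by split=> //; exact: walk_drop.
Qed.

(** A walk of minimal length works: a repeated vertex could be cut out, and an edge between
    non-consecutive vertices would give a shortcut. *)
Lemma geodesic_walk x y s : walk x s y -> exists2 t, walk x t y &
  forall i j, i < j <= size t ->
    nth x (x :: t) i <> nth x (x :: t) j /\
    (i.+1 < j -> ~ adj (nth x (x :: t) i) (nth x (x :: t) j)).
Proof.
move=> xs; have [|_ [t xt <-] tmin] := @min_nat (fun n => exists2 t, walk x t y & size t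
  = n) (size s).
  by exists s.
exists t => // i j /andP[ij jt].
have it : i <= size t by lia.
have tm t' : walk x t' y -> size t <= size t' by move=> ?; apply: tmin; exists t'.
split=> [E|ij1 E].
  by have := tm _ (walk_cut it jt E xt); rewrite size_cat size_takel // size_drop; lia.
by have := tm _ (walk_shortcut it jt E xt); rewrite size_cat size_takel //= size_drop;
  lia.
Qed.

Lemma closed_walk_cycle x s : walk x s x -> 2 < size s ->
  (forall i j, i < j < size s -> nth x (x :: s) i <> nth x (x :: s) j) ->
  is_cycle (fun i : 'I_(size s) => nth x (x :: s) i).
Proof.
move=> xs s2 inj; split=> // [i j E|i].
  apply: val_inj; case: (ltngtP i j) => // ij; exfalso.
    by apply: (inj i j) => //; rewrite ij ltn_ord.
  by apply: (inj j i) => //; rewrite ij ltn_ord.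
have := walk_nth (ltn_ord i) xs; congr adj; rewrite /=.
have := ltn_ord i; rewrite leq_eqVlt => /predU1P[E|lt]; last by rewrite modn_small.
have := nth_walk_size xs; rewrite E modnn /=.
by rewrite -[X in nth _ _ X = _]E.
Qed.
Lemma is_cycle_ordS n (c : 'I_n -> G) : is_cycle c -> is_cycle (c \o @ordS n).
Proof.
move=> [n2 cinj cadj]; split=> // [|i]; last exact: cadj.
exact: inj_comp cinj (@ordS_inj n).
Qed.

Lemma codom_nth x s : codom (fun i : 'I_(size s) => nth x s i) = s.
Proof.
by rewrite codomE (map_comp (nth x s)) val_enum_ord -/(mkseq _ _) mkseq_nth.
Qed.

Lemma ordS_neq n (i j : 'I_n) : i < j -> i.+1 <> j -> ~ (i = 0 :> nat /\ j.+1 = n) ->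
  j <> ordS i /\ i <> ordS j.
Proof.
move=> ij ij1 w; have := ltn_ord j; split=> /(congr1 val) /= E.
  by move: E; rewrite modn_small; lia.
case: (ltngtP j.+1 n) => [lt|lt|E']; [|lia|].
  by move: E; rewrite modn_small //; lia.
by move: E; rewrite E' modnn; lia.
Qed.

Lemma has_chordP n (c : 'I_n -> G) : 2 < n -> has_chord c ->
  exists i j : 'I_n, [/\ i < j, i.+1 <> j, ~ (i = 0 :> nat /\ j.+1 = n) &
    adj (c i) (c j)].
Proof.
move=> n2 [i [j [cij ji jj]]].
wlog ij : i j cij ji jj / i < j => [H|].
  case: (ltngtP i j) => ij; first exact: (H i j).
    by apply: (H j i) => //; exact: adj_sym.
  by case: (@adj_irrefl G (c i)); rewrite {2}(val_inj ij).
exists i, j; split=> // [E|[i0 jn]].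
  by apply: ji; apply: val_inj; rewrite /= modn_small ?E.
by apply: jj; apply: val_inj; rewrite /= jn modnn.
Qed.
End Walks.

(** * Lifting walks *)

Lemma walk_catI (G : graph) (x y : G) s t : walk x (s ++ t) y ->
  walk x s (last x s) /\ walk (last x s) t y.
Proof. by elim: s x => [|z s IH] x //= [xz /IH [? ?]]. Qed.

(** Evaluation of a 1-cochain with values in Z/2 on a walk. *)
Fixpoint parity (G : graph) (f : G -> G -> bool) (x : G) (s : seq G) : bool :=
  if s is y :: s' then f x y (+) parity f y s' else false.

Lemma cat_split (T : Type) (s1 s2 t1 t2 : seq T) : size s1 = size s2 ->
  s1 ++ t1 = s2 ++ t2 -> s1 = s2 /\ t1 = t2.
Proof.
by elim: s1 s2 => [|a s1 IH] [|b s2] //= [/IH h] [-> /h [-> ->]].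
Qed.

Lemma rev_walkK (G : graph) (x y : G) s : walk x s y ->
  rev_walk y (rev_walk x s) = s.
Proof.
rewrite /rev_walk; case: s => [|z s] //= [_ /walk_last <-].
by rewrite rev_cons belast_rcons rev_cons revK -lastI.
Qed.

Lemma walk_of_nth (G : graph) (x : G) s :
  (forall i, i < size s -> adj (nth x (x :: s) i) (nth x s i)) ->
  walk x s (last x s).
Proof.
elim: s x => [|z s IH] x //= h; split; first exact: (h 0).
apply: IH => i ils; have := h i.+1 ils.
by rewrite /= (set_nth_default z x ils) (@set_nth_default _ (z :: s) z x) // ltnW.
Qed.

Lemma codom_cycle_walk (G : graph) n (c : 'I_n -> G) y : is_cycle c ->
  last y (codom c) = y -> walk y (codom c) (last y (codom c)).
Proof.
move=> [n2 _ cadj] cy; apply: walk_of_nth; rewrite size_codom card_ord => i lin.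
have cE k (kn : k < n) : nth y (codom c) k = c (Ordinal kn).
  rewrite codomE (nth_map (Ordinal kn)) ?size_enum_ord //.
  by congr (c _); apply: val_inj; rewrite /= nth_enum_ord.
have n1 : n.-1 < n by lia.
have yE : y = c (Ordinal n1).
  by rewrite -{1}cy -nth_last size_codom card_ord cE.
case: i lin => [|i] lin /=.
  rewrite {1}yE cE; have := cadj (Ordinal n1); congr (adj _ (c _)).
  by apply: val_inj; rewrite /= prednK ?modnn //; lia.
rewrite !cE; first by lia.
move=> lin'; have := cadj (Ordinal lin'); congr (adj _ (c _)).
by apply: val_inj; rewrite /= modn_small.
Qed.

Section Parity.
Variables (G : graph) (f : G -> G -> bool).
Hypothesis fC : forall x y, f x y = f y x.

Lemma parity_cat x s t : parity f x (s ++ t) = parity f x s (+) parity f (last x s) t.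
Proof. by elim: s x => [|y s IH] x //=; rewrite IH addbA. Qed.

Lemma parity_rev x y s : walk x s y -> parity f y (rev_walk x s) = parity f x s.
Proof.
rewrite /rev_walk; elim: s x => [|z s IH] x //= [_ zs].
rewrite rev_cons -cats1 parity_cat IH //= (walk_last (walk_rev zs)).
by rewrite addbF fC addbC.
Qed.

Lemma parity_split x s i j : i <= j <= size s ->
  parity f x s = parity f x (take i s) (+)
    parity f (nth x (x :: s) i) (drop i (take j s)) (+)
    parity f (nth x (x :: s) j) (drop j s).
Proof.
move=> /andP[ij js].
have lastE k : k <= size s -> last x (take k s) = nth x (x :: s) k.
  move=> ks; rewrite (last_nth x) size_takel // -[x :: take k s]/(take k.+1 (x :: s)).
  by rewrite nth_take.
rewrite -{1}(cat_take_drop j s) parity_cat lastE //; congr (_ (+) _).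
rewrite -{1}(cat_take_drop i (take j s)) parity_cat take_takel //.
by rewrite lastE //; exact: leq_trans ij js.
Qed.
End Parity.

Section Coverings.
Variables (H G : graph) (p : H -> G).
Hypothesis cov : covering p.

Lemma covering_adj x y : adj x y -> adj (p x) (p y).
Proof. by case: cov => _ h _; exact: h. Qed.

Lemma covering_lift x v : adj (p x) v -> exists2 y, adj x y & p y = v.
Proof. by case: cov => _ _ /(_ x) [_ _ h] /h [y ? ?]; exists y. Qed.

Lemma covering_inj x y z : adj x y -> adj x z -> p y = p z -> y = z.
Proof. by case: cov => _ _ /(_ x) [_ h _] xy xz; apply: h; rewrite in_setE. Qed.

Lemma walk_map x s y : walk x s y -> walk (p x) (map p s) (p y).
Proof.
elim: s x => [|z s IH] x /=; first by move=> ->.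
by move=> [xz /IH]; split=> //; exact: covering_adj.
Qed.

Lemma walk_lift x s v : walk (p x) s v ->
  exists t y, [/\ walk x t y, map p t = s & p y = v].
Proof.
elim: s x => [|w s IH] x /=; first by move=> <-; exists [::], x.
move=> [/covering_lift [z xz <-] /IH [t [y [zt <- <-]]]].
by exists (z :: t), y.
Qed.

Lemma lift_uniq x s t y z : walk x s y -> walk x t z ->
  map p s = map p t -> s = t.
Proof.
elim: s x t => [|a s IH] x [|b t] //= [xa sy] [xb tz] [pab pst].
have ab := covering_inj xa xb pab; rewrite -ab in tz *.
by rewrite (IH _ _ sy tz).
Qed.

Lemma rev_walk_map x s : map p (rev_walk x s) = rev_walk (p x) (map p s).
Proof. by rewrite /rev_walk map_rev belast_map. Qed.

(** End vertex and label sum of the lift are tracked together, so that one homotopy invariance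
    serves both for closing short walks (with the zero label) and for labellings. *)
Definition lifted (f : H -> H -> bool) x s y b :=
  exists t, [/\ walk x t y, map p t = s & parity f x t = b].

(** A backtrack lifts to a backtrack, which passes one edge twice and so contributes zero over
    Z/2. *)
Lemma homotopic_lifted f : (forall x y, f x y = f y x) -> forall x s t y b,
  homotopic (p x) s t -> lifted f x s y b <-> lifted f x t y b.
Proof.
move=> fC x s t y b; elim=> {s t} [s|s t _|s t u _ IH1 _ IH2|s v t lv] //.
- by move=> IH; split=> /IH.
- exact: (iff_trans IH1).
split=> -[u [xu pu ub]].
- move: pu; rewrite -(cat_take_drop (size s) u) in xu ub *.
  set u1 := take _ u in xu ub *; set u2 := drop _ u in xu ub *.
  have [xu1 u2y] := walk_catI xu.
  rewrite map_cat => pu.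
  have szs : size (map p u1) = size s.
    have := congr1 size pu; rewrite !size_cat !size_map /u1 /u2 size_drop size_take.
    by case: ltnP; lia.
  have [pu1 pu2] := cat_split szs pu.
  have [w zw pw] : exists2 w, adj (last x u1) w & p w = v.
    by apply: covering_lift; rewrite -(last_map p) pu1.
  exists (u1 ++ w :: last x u1 :: u2); split.
  + by apply: walk_cat xu1 _; split=> //; split=> //; exact: adj_sym.
  + by rewrite map_cat /= pu1 pu2 pw -(last_map p) pu1.
  + by rewrite -ub !parity_cat /= (fC w) addKb.
- have szs : size s <= size u by rewrite -(size_map p) pu size_cat; lia.
  move: pu; rewrite -(cat_take_drop (size s) u) in xu ub *.
  set u1 := take _ u in xu ub *; set u2 := drop _ u in xu ub *.
  have [xu1 u2y] := walk_catI xu.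
  rewrite map_cat => pu.
  have szs1 : size (map p u1) = size s by rewrite size_map size_takel.
  have [pu1 pu2] := cat_split szs1 pu.
  (* The vertex after [w] and the vertex [last x u1] are neighbours of [w] with the same image,
     hence equal. *)
  case: u2 u2y pu2 xu ub {pu} => [|w [|z u2]] //= [zw [wz u2y]] [pw pz pu2] xu ub.
  have E : z = last x u1.
    apply: (covering_inj wz (adj_sym zw)).
    by rewrite pz -(last_map p) pu1.
  rewrite {}E in wz u2y pz xu ub.
  exists (u1 ++ u2); split.
  + exact: walk_cat xu1 u2y.
  + by rewrite map_cat pu1 pu2.
  + by rewrite -ub !parity_cat /= (fC w) addKb.
Qed.

Lemma lifted_cat f x s y z t b c : lifted f x s y b -> lifted f y t z c ->
  lifted f x (s ++ t) z (b (+) c).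
Proof.
move=> [u [xu <- <-]] [v [yv <- <-]]; exists (u ++ v); split.
- exact: walk_cat xu yv.
- exact: map_cat.
- by rewrite parity_cat (walk_last xu).
Qed.

Lemma lifted_rev f x s y b : (forall x y, f x y = f y x) -> lifted f x s y b ->
  lifted f y (rev_walk (p x) s) x b.
Proof.
move=> fC [u [xu <- <-]]; exists (rev_walk x u); split.
- exact: walk_rev.
- exact: rev_walk_map.
- exact: parity_rev xu.
Qed.

Lemma lifted_fun f x s y z b c : lifted f x s y b -> lifted f x s z c ->
  y = z /\ b = c.
Proof.
move=> [u [xu us <-]] [v [xv vs <-]].
have E : u = v by apply: (lift_uniq xu xv); rewrite us vs.
by split; rewrite ?E // -(walk_last xu) -(walk_last xv) E.
Qed.
End Coverings.

(** * Short closed walks in the local cover *)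

Section LocalCovering.
Variables (r : nat) (H G : graph) (p : H -> G).
Hypothesis hp : local_covering r p.

Let cov : covering p. Proof. by case: hp. Qed.

(** Strong induction on the length. If a proper subwalk has ends with the same image, it is closed
    by induction and can be cut out. Otherwise the projection is a cycle of length at most [r],
    hence after conjugation a generator of the local subgroup, and so it lifts to a closed walk;
    lengths up to 2 follow from injectivity on edges. *)
Lemma short_walk_closed z t z' : walk z t z' -> size t <= r -> p z = p z' -> z = z'.
Proof.
move: {2}(size t).+1 (ltnSn (size t)) => n; elim: n z t z' => // n IH z t z' tn zt tr pz.
have [[i [j [ij jt ij_short E]]]|inj] := pselect (exists i j, [/\ i < j, j <= size t,
    j - i < size t & p (nth z (z :: t) i) = p (nth z (z :: t) j)]).
  have it : i <= size t by lia.
  have ijt : i <= j <= size t by lia.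
  have ss : size (drop i (take j t)) = j - i by rewrite size_drop size_takel.
  have {}E := IH _ _ _ _ (walk_sub ijt zt) _ E.
  apply: (IH _ _ _ _ (walk_cut it jt (E _ _) zt)) => //; rewrite ?ss;
    rewrite ?size_cat ?size_takel ?size_drop //; lia.
case: (ltnP 2 (size t)) => t2; last first.
  case: t t2 zt {tn tr inj} => [|a [|b []]] //= _ [za].
    by move=> E; case: (@adj_irrefl G (p z)); rewrite {2}pz -E; exact: covering_adj za.
  by move=> [ab E]; rewrite -{}E in pz *; apply: (covering_inj cov (adj_sym za) ab).
have pt : walk (p z) (map p t) (p z) by rewrite {2}pz; exact: walk_map.
have cyc : is_cycle (fun i : 'I_(size (map p t)) => nth (p z) (p z :: map p t) i).
  apply: closed_walk_cycle pt _ _; rewrite size_map // => i j /andP[ij jt] E.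
  apply: inj; exists i, j; split; rewrite ?(ltnW jt) //; first by lia.
  by move: E; rewrite -map_cons !(nth_map z) //= ltnS ltnW //; lia.
case: hp => -[_ conn] _ [x hx].
have [W xW] := conn x z.
(* The generator lists its cycle with the base point last, hence the rotation by [ordS]. *)
have cn : codom ((fun i : 'I_(size (map p t)) => nth (p z) (p z :: map p t) i) \o @ordS
  _) = map p t.
  rewrite -[RHS](codom_nth (p z)); apply: eq_codom => i /=.
  have := ltn_ord i; rewrite leq_eqVlt => /predU1P[E|lt].
    rewrite [i.+1]E modnn /= -{1}(nth_walk_size pt) -[in LHS]E.
    by [].
  by rewrite modn_small.
have := @local_subgroup_gen G r (p x) (map p W) (p z) _ _ (walk_map cov xW)
  (is_cycle_ordS cyc).
rewrite cn size_map => /(_ tr (walk_last pt)) gen.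
have wgen : walk (p x) (map p W ++ map p t ++ rev_walk (p x) (map p W)) (p x).
  apply: walk_cat (walk_map cov xW) _; apply: walk_cat pt _.
  exact: walk_rev (walk_map cov xW).
have /hx [] := gen; first by [].
pose f0 (x y : H) := false.
move=> u xu /(@homotopic_lifted _ _ _ cov f0 (fun _ _ => erefl) _ _ _ x (parity f0 x u))
  [hl _].
have {}hl : lifted p f0 x (map p W ++ map p t ++ rev_walk (p x) (map p W)) x (parity f0 x
  u).
  by apply: hl; exists u.
have lW : lifted p f0 x (map p W) z (parity f0 x W) by exists W.
have lt : lifted p f0 z (map p t) z' (parity f0 z t) by exists t.
have [v [y [z'v pv py]]] : exists v y, [/\ walk z' v y, map p v = rev_walk (p x) (map p
  W) & p y = p x].
  by apply: (walk_lift cov); rewrite -pz; exact: walk_rev (walk_map cov xW).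
have lv : lifted p f0 z' (rev_walk (p x) (map p W)) y (parity f0 z' v) by exists v.
have [yx _] := lifted_fun cov (lifted_cat lW (lifted_cat lt lv)) hl.
(* Reversing the last part of the closed lift gives a lift of [map p W] from [x] that ends in [z'],
   whereas [W] itself ends in [z]. *)
have := lifted_rev (f := f0) (fun _ _ => erefl) lv.
rewrite yx -pz (rev_walkK (walk_map cov xW)) => lW'.
by have [] := lifted_fun cov lW lW'.
Qed.

(** By induction on the local subgroup, each of its elements lifts at [x] to a closed walk with sum
    zero; generators lift to a short closed walk conjugated by a walk, whose two passages cancel.
    Every closed walk at [x] projects into the local subgroup. *)
Lemma short_cocycle (f : H -> H -> bool) : (forall x y, f x y = f y x) ->
  (forall z t, walk z t z -> size t <= r -> parity f z t = false) ->
  forall z t, walk z t z -> parity f z t = false.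
Proof.
move=> fC short.
case: hp => -[_ conn] _ [x hx].
have loc s : local_subgroup r (p x) s -> lifted p f x s x false.
  elim=> {s} [|W y n c pW cyc nr cy|s t _ IHs _ IHt|s _ IH|s t st _ IH].
  - by exists [::].
  - have [U [z [xU pU pz]]] := walk_lift cov pW.
    have yc : walk y (codom c) y by rewrite -{2}cy; exact: codom_cycle_walk.
    rewrite -pz in yc; have [t [z' [zt pt pz']]] := walk_lift cov yc.
    have tr : size t <= r by rewrite -(size_map p) pt size_codom card_ord.
    have zz : z = z' by apply: (short_walk_closed zt tr).
    subst z'.
    have lU : lifted p f x W z (parity f x U) by exists U.
    have lt : lifted p f z (codom c) z (parity f z t) by exists t.
    have := lifted_cat lU (lifted_cat lt (lifted_rev fC lU)).
    by rewrite (short _ _ zt tr) addFb addbb.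
  - exact: lifted_cat IHs IHt.
  - exact: lifted_rev.
  - exact/(homotopic_lifted cov fC x false st).
have closed_x t : walk x t x -> parity f x t = false.
  move=> xt; have lt : lifted p f x (map p t) x (parity f x t) by exists t.
  have /loc l : local_subgroup r (p x) (map p t).
    apply/hx; first exact: walk_map.
    by exists t => //; exact: homotopic_refl.
  by have [] := lifted_fun cov lt l.
move=> z t zt; have [W xW] := conn x z.
have := closed_x _ (walk_cat xW (walk_cat zt (walk_rev xW))).
rewrite !parity_cat (walk_last xW) (walk_last zt) (parity_rev fC xW).
by rewrite addbCA addbb addbF.
Qed.
End LocalCovering.

(** * Holes *)

Lemma sval_inj (T : Type) (P : T -> Prop) (a b : {x | P x}) :
  sval a = sval b -> a = b.
Proof. by case: a b => a Pa [b Pb] /= E; exact: eq_exist. Qed.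

(** A relation on vertices of [G] rather than on those of [induced P], so that the set can be
    changed without moving between subtypes. *)
Inductive conn (G : graph) (P : set G) : G -> G -> Prop :=
| conn_refl x : P x -> conn P x x
| conn_step x y z : P x -> adj x y -> conn P y z -> conn P x z.

Section Conn.
Variable G : graph.
Implicit Types (P Q : set G) (x y z : G).

Lemma conn_left P x y : conn P x y -> P x. Proof. by case. Qed.

Lemma conn_right P x y : conn P x y -> P y. Proof. by elim. Qed.

Lemma conn_sub P Q x y : P `<=` Q -> conn P x y -> conn Q x y.
Proof.
move=> PQ; elim=> {x y} [x /PQ Px|x y z /PQ Px xy _ IH]; first exact: conn_refl.
exact: conn_step xy IH.
Qed.

Lemma conn_trans P x y z : conn P x y -> conn P y z -> conn P x z.
Proof. by elim=> {x y} // x y w Px xy _ IH /IH; exact: conn_step. Qed.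

Lemma conn_adj P x y : P x -> P y -> adj x y -> conn P x y.
Proof. by move=> Px Py xy; apply: conn_step xy (conn_refl Py). Qed.

Lemma conn_sym P x y : conn P x y -> conn P y x.
Proof.
elim=> {x y} [x|x y z Px xy yz IH]; first exact: conn_refl.
by apply: conn_trans IH (conn_adj _ _ (adj_sym xy)) => //; exact: conn_left yz.
Qed.

Lemma walk_conn x s y : walk x s y -> conn setT x y.
Proof.
elim: s x => [|z s IH] x /=; first by move=> ->; exact: conn_refl.
by move=> [xz /IH]; exact: conn_step.
Qed.

Lemma conn_walk P x y : conn P x y -> exists2 s, walk x s y &
  forall i, i <= size s -> P (nth x (x :: s) i).
Proof.
elim=> {x y} [x Px|x y z Px xy _ [s ys Ps]].
  by exists [::] => // -[].
exists (y :: s) => //= -[|i] //= ils.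
by have := Ps i ils; rewrite (@set_nth_default _ (y :: s) y x).
Qed.

Lemma conn_induced P x y (Px : P x) (Py : P y) : conn P x y ->
  exists s, @walk (induced P) (exist _ x Px) s (exist _ y Py).
Proof.
move=> xy; elim: xy Px Py => {x y} [x _|x y z _ xy yz IH] Px Py.
  by exists [::] => /=; congr (exist _ _ _); exact: Prop_irrelevance.
have [s ys] := IH (conn_left yz) Py.
by exists (exist _ y (conn_left yz) :: s).
Qed.

Lemma walk_induced P (x y : induced P) s : walk x s y -> conn P (sval x) (sval y).
Proof.
elim: s x => [|z s IH] x /=.
  by move=> ->; apply: conn_refl; exact: svalP.
by move=> [xz /IH]; apply: conn_step => //; exact: svalP.
Qed.

Lemma walk_sval P (x y : induced P) s : walk x s y ->
  walk (sval x) (map sval s) (sval y).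
Proof. by elim: s x => [|z s IH] x /=; [move=> -> | move=> [xz /IH]]. Qed.

Lemma conn_exit P Q x y : conn P x y -> Q x -> ~ Q y ->
  exists z w, [/\ Q z, ~ Q w, adj z w & P z /\ P w].
Proof.
elim=> {x y} [x _ //|x y z Px xy yz IH Qx Qz].
have [Qy|Qy] := pselect (Q y); first exact: IH.
by exists x, y; split=> //; split=> //; exact: conn_left yz.
Qed.

Lemma conn_last P Q x y : conn P x y -> Q x -> exists w, [/\ Q w, conn P x w &
  w = y \/ exists2 e, adj w e & conn (P `\` Q) e y].
Proof.
move=> xy Qx.
suff : (exists w, [/\ Q w, conn P x w & w = y \/ exists2 e, adj w e & conn (P `\` Q) e y])
    \/ conn (P `\` Q) x y.
  by case=> // /conn_left [].
elim: xy {Qx} => {x y} [x Px|x y z Px xy yz [[w [Qw yw wz]]|IH]].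
- have [Qx|Qx] := pselect (Q x); last by right; exact: conn_refl.
  by left; exists x; split; [|exact: conn_refl|left].
- by left; exists w; split=> //; exact: conn_step yw.
- have [Qx|Qx] := pselect (Q x); last by right; apply: conn_step xy _.
  by left; exists x; split; [|exact: conn_refl|right; exists y].
Qed.

(** Each excursion of the path outside [Q] leaves at some [x0] and returns at some [y0]; by
    hypothesis it can be replaced by at most one edge. *)
Lemma conn_shortcut P Q x y :
  (forall x0 e w y0, P x0 -> Q x0 -> P y0 -> Q y0 -> adj x0 e ->
    conn (P `\` Q) e w -> adj w y0 -> x0 = y0 \/ adj x0 y0) ->
  Q x -> Q y -> conn P x y -> conn (P `&` Q) x y.
Proof.
move=> PQ Qx Qy xy.
(* Generalised for the induction: [x0] is the last vertex of [Q] met so far, and [x] is the current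
   vertex, possibly inside an excursion from [x0]. *)
suff : forall x0, P x0 -> Q x0 ->
    x0 = x \/ (exists2 e, adj x0 e & conn (P `\` Q) e x) -> conn (P `&` Q) x0 y.
  by apply=> //; [exact: conn_left xy | left].
elim: xy Qy {Qx} => {x y} [x Px|x y z Px xy yz IH] Qz x0 Px0 Qx0 x0x.
  by case: x0x => [->|[e _ /conn_right []]] //; exact: conn_refl.
have Py := conn_left yz.
have [Qy|Qy] := pselect (Q y).
  have yz' : conn (P `&` Q) y z by apply: IH => //; left.
  have [->//|xy0] : x0 = y \/ adj x0 y; last exact: conn_step xy0 yz'.
  by case: x0x => [->|[e x0e ex]]; [right | exact: PQ ex xy].
apply: IH => //; right; case: x0x => [->|[e x0e ex]].
  by exists y => //; exact: conn_refl.
by exists e => //; apply: conn_trans ex (conn_adj (conn_right ex) _ xy).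
Qed.
End Conn.

(** Chordality of the subgraph induced on [S], expressed by cycles of [G] itself. *)
Definition hole_free (G : graph) (S : set G) : Prop :=
  forall n (c : 'I_n -> G), 3 < n -> (forall i, S (c i)) -> is_cycle c ->
    has_chord c.

Section Hole.
Variables (G : graph) (S : set G).
Hypothesis hS : hole_free S.

(** Otherwise a shortest path from [x] to [y] with interior in [Z], closed up through [u], is a
    hole. *)
Lemma hole_free_adj u x y e e' Z : S u -> S x -> S y -> adj u x -> adj u y ->
  adj x e -> conn Z e e' -> adj e' y -> Z `<=` S ->
  (forall z, Z z -> z <> u /\ ~ adj u z) -> x = y \/ adj x y.
Proof.
move=> Su Sx Sy ux uy xe ee ey ZS Zu.
apply: contrapT => /not_orP[xy nxy].
pose Q := Z `|` [set x; y].
have Qx : Q x by right; left.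
have Qy : Q y by right; right.
have cQ : conn Q x y.
  apply: conn_step Qx xe _; apply: conn_trans (_ : conn Q e e') _.
    by apply: conn_sub ee => z; left.
  by apply: conn_adj => //; left; exact: conn_right ee.
have [s0 s0w] := conn_induced Qx Qy cQ.
have {s0 s0w} [t xt tgeo] := geodesic_walk s0w.
set x' : induced Q := exist _ x Qx in xt tgeo; set y' := exist _ y Qy in xt.
pose v k := sval (nth x' (x' :: t) k).
pose s := map sval (x' :: t) ++ [:: u].
have sz : size s = (size t).+2 by rewrite size_cat size_map addn1.
have vE k : k <= size t -> nth u (u :: s) k.+1 = v k.
  by move=> kt; rewrite /= nth_cat size_map ltnS kt (nth_map x').
have vy : v (size t) = y by rewrite /v (nth_walk_size xt).
have us : walk u s u.
  rewrite /s /=; split=> //; apply: walk_cat (_ : walk x (map sval t) y) _.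
    exact: (walk_sval xt).
  by split=> //; exact: adj_sym.
have vinj i j : i < j <= size t -> v i <> v j.
  by move=> ij E; have [+ _] := tgeo i j ij; apply; exact: sval_inj.
have vu k : k <= size t -> v k <> u.
  move=> kt E; have := svalP (nth x' (x' :: t) k); rewrite -/(v k) E.
  case=> [/Zu [] //|[]] E'; [move: ux|move: uy]; rewrite E'; exact: adj_irrefl.
(* Since [x] and [y] are distinct and non-adjacent, the path has at least three vertices, and with
   [u] the cycle has at least four. *)
have t2 : 1 < size t.
  case: (t) xt => [|a [|? ?]] //=; first by move/(congr1 sval).
  by move=> [xa ay]; rewrite ay in xa.
have vQ k : k <= size t -> 0 < k < size t -> Z (v k).
  move=> kt /andP[k0 kl]; case: (svalP (nth x' (x' :: t) k)); rewrite -/(v k) //.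
  case=> E; first by case: (vinj 0 k) => //; lia.
  by case: (vinj k (size t)); [lia | rewrite vy].
have inj i j : i < j < size s -> nth u (u :: s) i <> nth u (u :: s) j.
  rewrite sz; case: j => // j /andP[ij jt]; rewrite vE //.
  case: i ij => [_ /esym|i ij]; first by apply: vu; lia.
  by rewrite vE; [apply: vinj; lia | lia].
have uS i : S (nth u (u :: s) i).
  case: (leqP i (size t).+1) => it; last first.
    case: (ltngtP i (size s)) => ti; first by lia.
      by rewrite nth_default //=.
    by rewrite ti (nth_walk_size us).
  case: i it => // i it; rewrite vE //.
  by case: (svalP (nth x' (x' :: t) i)) => [/ZS|[] E] //; rewrite /v E.
have s2 : 2 < size s by rewrite sz; lia.
have s3 : 3 < size s by rewrite sz; lia.
have /(has_chordP s2) := hS s3 (fun i => uS i) (closed_walk_cycle us s2 inj).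
move=> [[i il] [[j jl] []]].
clearbody s; rewrite /= in il jl *; rewrite sz in il jl *.
case: j jl => // j jl ij ij1 w; rewrite vE //.
(* Position 0 of the cycle is [u] and position [k.+1] is [v k]. A chord at [u] would end in [Z]; any
   other chord would shorten the geodesic. *)
case: i il ij ij1 w => [|i] il ij ij1 w /= a.
  have jt : 0 < j < size t by lia.
  by have [_] := Zu _ (vQ j ltac:(lia) jt).
have {}a : adj (nth u (u :: s) i.+1) (v j) := a.
rewrite vE in a; last by lia.
have ijt : i < j <= size t by lia.
by have [_] := tgeo i j ijt; apply=> //; lia.
Qed.

(** An excursion outside the neighbourhood of [u] runs through non-neighbours of [u], so
    [hole_free_adj] shortcuts it. *)
Lemma hole_free_conn u P x y : S u -> P `<=` S -> ~ P u -> adj u x -> adj u y ->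
  conn P x y -> conn (P `&` neighbours u) x y.
Proof.
move=> Su PS Pu; apply: conn_shortcut => x0 e w y0 Px0 ux0 Py0 uy0 x0e ew wy0.
apply: (hole_free_adj Su _ _ ux0 uy0 x0e ew wy0); try exact: PS.
  by move=> z [/PS].
by move=> z [Pz uz]; split=> // E; apply: Pu; rewrite -E.
Qed.

Definition far (u y : G) : set G :=
  [set z | conn (S `\` (u |` neighbours u)) y z].

(** For [y] in [S] that is neither [u] nor adjacent to it, this is the minimal separator of [u] and
    [y] in [S] closest to [u]. *)
Definition far_boundary (u y : G) : set G :=
  [set w | [/\ S w, adj u w & exists2 z, far u y z & adj w z]].

(** Two boundary vertices are joined through the component [far u y], which contains no neighbour of
    [u]; hence [hole_free_adj] applies. *)
Lemma far_boundary_clique u y : S u -> clique (far_boundary u y).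
Proof.
move=> Su w1 w2 [Sw1 uw1 [z1 yz1 wz1]] [Sw2 uw2 [z2 yz2 wz2]] w12.
have c12 := conn_trans (conn_sym yz1) yz2.
case: (hole_free_adj Su Sw1 Sw2 uw1 uw2 wz1 c12 (adj_sym wz2)) => // z [Sz].
by move=> /not_orP[].
Qed.

Lemma far_exit u y x z : S x -> S z -> adj x z -> far u y z -> ~ far u y x ->
  far_boundary u y x.
Proof.
move=> Sx Sz xz yz yx; have [_ /not_orP[zu uz]] := conn_right yz.
have [E|xu] := pselect (x = u); first by case: uz; rewrite -E.
have [ux|ux] := pselect (adj u x); first by split=> //; exists z.
case: yx; apply: conn_trans yz (conn_adj (conn_right yz) _ (adj_sym xz)).
by split=> // -[].
Qed.
End Hole.

Lemma cycle_conn (G : graph) n (c : 'I_n -> G) (P : set G) (i j : 'I_n) :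
  is_cycle c -> i <= j -> (forall k : 'I_n, i <= k <= j -> P (c k)) ->
  conn P (c i) (c j).
Proof.
move=> [_ _ cadj]; case: j => j jn /=; elim: j jn => [|j IH] jn ij Pc.
  have -> : i = Ordinal jn by apply: val_inj => /=; lia.
  by apply: conn_refl; apply: Pc => /=; lia.
have [E|E] := eqVneq (val i) j.+1.
  have -> : i = Ordinal jn by apply: val_inj.
  by apply: conn_refl; apply: Pc => /=; rewrite leqnn andbT -E.
have jn' : j < n by lia.
apply: conn_trans (_ : conn P (c i) (c (Ordinal jn'))) _.
  apply: IH => [|k ik]; first by move: E => /= E; lia.
  by apply: Pc; lia.
apply: conn_adj; [apply: Pc => /=; move: E => /=; lia|apply: Pc => /=; lia|].
have := cadj (Ordinal jn'); congr (adj _ (c _)).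
by apply: val_inj; rewrite /= modn_small.
Qed.

(** * Graphs with chordal links *)

(** On [P] the labelling is the coboundary of [g], so the sum telescopes. *)
Lemma parity_coboundary (G : graph) (f : G -> G -> bool) (g : G -> bool)
    (P : set G) x s y :
  (forall a b, P a -> P b -> adj a b -> f a b = g a (+) g b) -> walk x s y ->
  (forall i, i <= size s -> P (nth x (x :: s) i)) -> parity f x s = g x (+) g y.
Proof.
move=> fP; elim: s x => [|z s IH] x /=; first by move=> ->; rewrite addbb.
move=> [xz zs] Ps; rewrite fP //; [|exact: (Ps 0)|exact: (Ps 1)].
rewrite (IH z zs) ?addbA ?addbK // => i ils; have := Ps i.+1 ils.
by rewrite /= (@set_nth_default _ (z :: s) z x).
Qed.

Section LinkChordal.
Variable H : graph.
Hypothesis link : forall l : H, hole_free (neighbours l).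
(** The first cohomology of the clique complex with coefficients in Z/2 vanishes. *)
Hypothesis cocycle : forall f : H -> H -> bool, (forall x y, f x y = f y x) ->
  (forall x y z, adj x y -> adj y z -> adj x z -> f x y (+) f y z (+) f x z = false) ->
  forall z t, walk z t z -> parity f z t = false.

Section Clique.
Variable K : set H.
Hypothesis Kc : clique K.

Let N l : set H := neighbours l `\` K.

(** As [m] lies in the chordal link of [l], a path there between neighbours of [m] retracts into the
    neighbourhood of [m]. *)
Lemma link_conn l m x y : K l -> K m -> adj m x -> adj m y ->
  conn (N l) x y -> conn (N m) x y.
Proof.
move=> Kl Km mx my; have [->|lm] := pselect (l = m); first by [].
have lm' := Kc Kl Km lm.
move=> /(hole_free_conn (@link l) lm' _ _ mx my) c.
apply: conn_sub (c _ _) => [z [[_ Kz] mz]|z []|[_]] //.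
Qed.

(* The component of [v]'s link minus [K] that contains [a] is spread over the
   links of all vertices of [K]. *)
Definition spread (v a : H) : set H :=
  [set z | exists l z', [/\ K l, conn (N v) a z', adj l z' & conn (N l) z' z]].

Lemma spread_link v a z : K v -> spread v a z -> adj v z -> conn (N v) a z.
Proof.
move=> Kv [l [z' [Kl az' lz' zz']]] vz; apply: conn_trans (az') _.
by apply: link_conn zz' => //; have [] := conn_right az'.
Qed.

Lemma spread_notin v a z : spread v a z -> ~ K z.
Proof. by move=> [l [z' [_ _ _ /conn_right []]]]. Qed.

(** The aim is a vertex [w] in the component of [a] that is adjacent to [m] and joined to [z] in the
    link of [l]. The last neighbour of [v] on the path from [z'] to [z] qualifies; the rest of the
    path then moves to the link of [m], where the edge to [y] is appended. *)
Lemma spread_closed v a m z y : K v -> spread v a z -> K m -> adj m z -> adj m y ->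
  adj z y -> ~ K y -> spread v a y.
Proof.
move=> Kv [l [z' [Kl az' lz' zz']]] Km mz my zy Ky.
have vz' : adj v z' by have [] := conn_right az'.
have [w [vw z'w wz]] := conn_last zz' vz'.
have [lw Kw] := conn_right z'w; have [lz Kz] := conn_right zz'.
have aw : conn (N v) a w by apply: conn_trans az' (link_conn Kl Kv vz' vw z'w).
have wz' : conn (N l) w z by apply: conn_trans (conn_sym z'w) zz'.
(* In the link of [l], both [w] and [m] are neighbours of [v], and the rest of the path joins them
   while avoiding the neighbourhood of [v]. *)
have mw : adj m w.
  case: wz => [->//|[e we ez]].
  have [->//|mv] := pselect (m = v).
  have [->//|ml] := pselect (m = l).
  have [lv|lv] := pselect (l = v).
    by have [[+ _]] := conn_left ez; rewrite lv.
  have [] := @hole_free_adj _ _ (@link l) v w m e z (N l `\` neighbours v) => //.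
  - exact: Kc.
  - by apply: Kc => // /esym.
  - by apply: Kc => // /esym.
  - exact: adj_sym.
  - by move=> x [[]].
  - by move=> x [[_ Kx] vx]; split=> // E; apply: Kx; rewrite E.
  - by move=> E; case: Kw; rewrite E.
  - exact: adj_sym.
exists m, w; split=> //; apply: conn_trans (link_conn Kl Km mw mz wz') _.
by apply: conn_adj.
Qed.

Lemma spread_cocycle v a z t : K v -> walk z t z ->
  parity (fun x y => `[<K x>] && `[<spread v a y>] || `[<K y>] && `[<spread v a x>]) z t
    = false.
Proof.
move=> Kv; apply: cocycle => [x y|{z t} x y z xy yz xz]; first by rewrite orbC.
have KD u : `[<K u>] -> `[<spread v a u>] = false.
  by move=> /asboolP Ku; apply/asboolP => /spread_notin.
have D m u w : `[<K m>] -> ~~ `[<K u>] -> ~~ `[<K w>] -> adj m u -> adj m w -> adj u w ->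
    `[<spread v a u>] = `[<spread v a w>].
  move=> /asboolP Km /asboolPn Ku /asboolPn Kw mu mw uw.
  apply: asbool_equiv_eq; split=> h; first exact: spread_closed h Km mu mw uw Kw.
  exact: spread_closed h Km mw mu (adj_sym uw) Ku.
case Kx : `[<K x>]; case Ky : `[<K y>]; case Kz : `[<K z>];
  rewrite ?(KD _ Kx) ?(KD _ Ky) ?(KD _ Kz) //= ?orbF ?addbb ?addbF ?addFb ?addbb //.
- by rewrite (D x y z) ?Kx ?Ky ?Kz // addbb.
- by rewrite (D y x z) ?Kx ?Ky ?Kz ?addbb //; exact: adj_sym.
- by rewrite (D z y x) ?Kx ?Ky ?Kz ?addbb //; exact: adj_sym.
Qed.
End Clique.

Lemma link_no_hole (v a b e e' : H) : adj v a -> adj v b -> adj a e ->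
  conn [set z : H | z <> v /\ ~ adj v z] e e' -> adj e' b -> a <> b -> adj a b.
Proof.
move=> va vb ae ee eb ab; apply: contrapT => nab.
(* Within the link of [v], the boundary of the component of [b] away from [a] separates [a] from
   [b]. *)
pose K := v |` far_boundary (neighbours v) a b.
have Kc : clique K.
  have bc := far_boundary_clique (@link v) (y := b) va.
  move=> x y [->|Kx] [->|Ky] // xy; last exact: bc.
    by have [] := Ky.
  by have [? _ _] := Kx; exact: adj_sym.
have Kv : K v by left.
have Ka : ~ K a.
  by move=> [E|[_ /adj_irrefl]] //; move: va; rewrite E; exact: adj_irrefl.
have Kb : ~ K b.
  move=> [E|[_ ? _]] //; move: vb; rewrite E; exact: adj_irrefl.
have bb : far (neighbours v) a b b.
  by apply: conn_refl; split=> // -[/esym|].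
have Db : ~ spread K v a b.
  move=> /(spread_link Kc Kv) /(_ vb) abc.
  have Qa : (~` far (neighbours v) a b) a by move=> /conn_right [_]; apply; left.
  have Qb : ~ (~` far (neighbours v) a b) b by apply.
  have [x [y [nx ny xy [[vx Kx] [vy Ky]]]]] := conn_exit abc Qa Qb.
  by apply: Kx; right; apply: far_exit xy _ nx => //; exact: contrapT.
have Da : spread K v a a.
  by exists v, a; split=> //; apply: conn_refl.
have abK : conn (~` K) a b.
  apply: conn_step Ka ae _; apply: conn_trans (_ : conn (~` K) e e') _.
    by apply: conn_sub ee => z [zv vz] [//|[]].
  apply: conn_adj => //.
  by have [? ?] := conn_right ee; move=> [//|[]].
have [s aws sK] := conn_walk abK.
(* The walk goes from [v] to [a], outside [K] to [b], and back to [v]; its only labelled edge is the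
   first one. *)
have := @spread_cocycle K Kc v a v (a :: s ++ [:: v]) Kv.
rewrite /= parity_cat (@parity_coboundary _ _ (fun=> false) (~` K) _ _ _ _ aws sK); last
  first.
  by move=> x y Kx Ky _; rewrite (asboolF Kx) (asboolF Ky).
rewrite /= (walk_last aws) !(asboolF Kb) (asboolF Db) !(asboolT Kv) (asboolT Da) /=.
move=> h; have : true = false; last by [].
by apply: h; split=> //; apply: walk_cat aws _; split=> //; exact: adj_sym.
Qed.

Lemma link_hole_free : hole_free [set: H].
Proof.
move=> n c n3 _ cyc; apply: contrapT => nch.
have [n2 cinj cadj] := cyc.
have nb (i j : 'I_n) : i < j -> i.+1 <> j -> ~ (i = 0 :> nat /\ j.+1 = n) -> ~ adj (c i)
  (c j).
  move=> ij ij1 w a; apply: nch; have [? ?] := ordS_neq ij ij1 w; by exists i, j.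
have l0 : 0 < n by lia.
have l1 : 1 < n by lia.
have m1 : n - 1 < n by lia.
have m2 : n - 2 < n by lia.
have m3 : n - 3 < n by lia.
apply: (nb (Ordinal l0) (Ordinal m2)) => /=; [lia|lia|lia|].
have nx i j (il : i < n) (jl : j < n) : j = i.+1 %% n -> adj (c (Ordinal il)) (c (Ordinal
  jl)).
  by move=> E; have := cadj (Ordinal il); congr (adj _ (c _)); apply: val_inj.
(* Taking the last vertex of the cycle for [v] makes the rest of the hole the interval of indices
   from 1 to [n - 3], without wrap-around; for [n = 4] it is a single vertex. *)
apply: (@link_no_hole (c (Ordinal m1)) _ _ (c (Ordinal l1)) (c (Ordinal m3))).
- by apply: nx; rewrite subn1 prednK ?modnn.
- by apply/adj_sym/nx; rewrite modn_small; lia.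
- by apply: nx; rewrite modn_small; lia.
- apply: cycle_conn cyc _ _ => /= [|k kk]; first by lia.
  split=> [/cinj E|/adj_sym]; first by move: kk; rewrite E /=; lia.
  by apply: nb => /=; lia.
- by apply: nx; rewrite modn_small; lia.
- by move=> /cinj /(congr1 val) /=; lia.
Qed.
End LinkChordal.

(** * The local cover of a locally chordal graph *)

Lemma is_dist_exists (G : graph) (v x : G) s : walk v s x ->
  exists2 m, is_dist v x m & m <= size s.
Proof.
move=> vs; have [|m [t vt <-] tmin] := @min_nat (fun n => exists2 t, walk v t x & size t
  = n) (size s).
  by exists s.
exists (size t); last by apply: tmin; exists s.
by split=> [|u vu]; [exists t | apply: tmin; exists u].
Qed.

Lemma is_dist_uniq (G : graph) (v x : G) m n : is_dist v x m -> is_dist v x n -> m = n.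
Proof.
by move=> [[s1 w1 <-] min1] [[s2 w2 <-] min2]; apply/eqP; rewrite eqn_leq min1 // min2.
Qed.

Lemma ball_chord (G : graph) (v : G) r n (c : 'I_n -> G) (m : 'I_n -> nat) :
  chordal (ball v r) -> 3 < n -> is_cycle c ->
  (forall i, is_dist v (c i) (m i)) -> (forall i, (m i).*2 <= r) ->
  (forall i, m i + m (ordS i) + 1 <= r) ->
  exists i j, [/\ adj (c i) (c j), j <> ordS i, i <> ordS j & m i + m j + 1 <= r].
Proof.
move=> ch n3 [n2 cinj cadj] cm mr mmr.
have cb i : ball_vertices v r (c i) by exists (m i).
pose b i : ball v r := exist _ (c i) (cb i).
have [|i [j [[/= cij [m1 [m2 [i1 j2 m12]]]] ji ij]]] := ch n b n3.
- split=> // [i j /(congr1 sval) /cinj //|i]; split; first exact: cadj.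
  by exists (m i), (m (ordS i)); split; [exact: cm|exact: cm|exact: mmr].
by exists i, j; split=> //; rewrite (is_dist_uniq (cm i) i1) (is_dist_uniq (cm j) j2).
Qed.

Section Cover.
Variables (r : nat) (H G : graph) (p : H -> G).
Hypotheses (hp : local_covering r p) (r3 : 2 < r).

Lemma local_covering_covering : covering p. Proof. by case: hp. Qed.
Let cov := local_covering_covering.

(** Lifting the edge at [y] gives a walk of length 3 from [z], which closes because [r] is at least
    3. *)
Lemma lift_triangle x y z : adj x y -> adj x z -> adj (p y) (p z) -> adj y z.
Proof.
move=> xy xz /(covering_lift cov) [z' yz' pz'].
have w : walk z [:: x; y; z'] z' by split; [exact: adj_sym|].
by rewrite (short_walk_closed hp w).
Qed.

Lemma covering_locally_finite : finite_set [set: G] -> locally_finite H.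
Proof.
move=> fG v; have [_ _ /(_ v) [_ inj _]] := cov.
have : finite_set (p @` neighbours v) by apply: sub_finite_set fG.
by rewrite (eq_finite_set (inj_card_eq inj)).
Qed.

Section Chordal.
Hypothesis lc : locally_chordal r G.

Lemma neighbours_hole_free (l : H) : hole_free (neighbours l).
Proof.
move=> n c n3 cl cyc; have [n2 cinj cadj] := cyc.
have pcyc : is_cycle (p \o c).
  split=> // [i j /= E|i]; last exact: covering_adj (cadj i).
  by apply: cinj; exact: (covering_inj cov (cl i) (cl j)).
have pl i : adj (p l) (p (c i)) by apply: covering_adj (cl i).
(* All vertices have distance 1 from [p l], so the edge condition of the ball reads
   [1 + 1 + 1 <= r]. *)
have [i|i|i|i [j [a ji ij _]]] := @ball_chord _ (p l) r _ _ (fun=> 1) (@lc (p l)) n3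
  pcyc; try lia.
- split; first by exists [:: p (c i)].
  by case=> // /= E; have := pl i; rewrite /= E => /adj_irrefl.
- by exists i, j; split=> //; exact: lift_triangle (cl i) (cl j) a.
Qed.

(** Induction on the length. A repetition in the projection splits the walk into two shorter closed
    walks. Otherwise, beyond length 3, the projection is a cycle in the ball around [p z]; its chord
    lifts and again splits the walk into two shorter ones. *)
Lemma short_parity (f : H -> H -> bool) : (forall x y, f x y = f y x) ->
  (forall x y z, adj x y -> adj y z -> adj x z -> f x y (+) f y z (+) f x z = false) ->
  forall z t, walk z t z -> size t <= r -> parity f z t = false.
Proof.
move=> fC f3 z t; move: {2}(size t).+1 (ltnSn (size t)) => n.
elim: n z t => // n IH z t tn zt tr.
have ssz i j : i <= j <= size t -> size (drop i (take j t)) = j - i.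
  by move=> /andP[ij jt]; rewrite size_drop size_takel.
have lastE k : k <= size t -> last z (take k t) = nth z (z :: t) k.
  by move=> kt; rewrite (walk_last (walk_take kt zt)).
have [[i [j [ij jt ij_short E]]]|inj] := pselect (exists i j, [/\ i < j, j <= size t,
    j - i < size t & p (nth z (z :: t) i) = p (nth z (z :: t) j)]).
  have it : i <= size t by lia.
  have ijt : i <= j <= size t by lia.
  have wij := walk_sub ijt zt.
  have {}E := short_walk_closed hp wij ltac:(rewrite ssz //; lia) E.
  rewrite (parity_split f z ijt) (IH (nth z (z :: t) i)) ?ssz //; [|lia|by rewrite
    {2}E|lia].
  rewrite addbF -E -lastE // -parity_cat (IH z) //.
  - by rewrite size_cat size_takel // size_drop; lia.
  - exact: walk_cut.
  - by rewrite size_cat size_takel // size_drop; lia.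
case: (leqP (size t) 3) => t3.
  case: t zt t3 {tn tr ssz lastE inj} => [|a [|b [|c []]]] //=.
  - by move=> [za az]; rewrite az in za; case: (adj_irrefl za).
  - by move=> [_ [_ ->]] _; rewrite (fC a) addbF addbb.
  - move=> [za [ab [bz cz]]] _; rewrite cz in bz *; rewrite addbF addbA (fC b) f3 //.
    exact: adj_sym.
have t2 : 2 < size (map p t) by rewrite size_map; lia.
have pt := walk_map cov zt.
have vE k : k <= size t -> nth (p z) (p z :: map p t) k = p (nth z (z :: t) k).
  by move=> kt; rewrite -map_cons (nth_map z).
have cyc : is_cycle (fun i : 'I_(size (map p t)) => nth (p z) (p z :: map p t) i).
  apply: closed_walk_cycle pt t2 _ => i j; rewrite size_map => /andP[ij jt] E.
  by apply: inj; exists i, j; split; try lia; rewrite -!vE //; lia.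
(* Going either way round the cycle bounds the distance by [i] and by [size t - i]; this puts the
   cycle and its edges into the ball. *)
have dist (i : 'I_(size (map p t))) : {m | is_dist (p z) (nth (p z) (p z :: map p t) i) m
  /\ (m <= i /\ m <= size t - i)}.
  apply: cid; have il : i <= size (map p t) by exact: ltnW.
  have := walk_rev (walk_drop il pt) => /is_dist_exists [m1 d1 l1].
  have [m2 d2 l2] := is_dist_exists (walk_take il pt).
  exists m2; split=> //; split; first by move: l2; rewrite size_takel.
  have [_ dm] := d2; have := dm _ (walk_rev (walk_drop il pt)).
  by rewrite size_rev_walk size_drop; have := size_map p t; lia.
have [i [j [ij ij1 w a]]] : exists i j, [/\ i < j < size t, i.+1 <> j, ~ (i = 0 /\ j.+1 =
  size t)
   & adj (p (nth z (z :: t) i)) (p (nth z (z :: t) j))].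
  have sz : size (map p t) = size t by rewrite size_map.
  have [|i|i|i|i0 [j0 [a ji ij _]]] := @ball_chord _ (p z) r _ _ (fun i => sval (dist i))
    (@lc (p z)) _ cyc.
  - by rewrite sz.
  - by case: (dist i) => m [].
  - by case: (dist i) => m /= [_ []]; have := ltn_ord i; lia.
  - case: (dist i) => m /= [_ [mi mi']]; case: (dist (ordS i)) => m' /= [_ [mi1 mi1']].
    have := ltn_ord i; rewrite leq_eqVlt => /predU1P[E|lt].
      by move: mi1 mi1'; rewrite E modnn; lia.
    by move: mi1 mi1'; rewrite modn_small; lia.
  have [i [j [lij ij1 w a']]] : exists i j : 'I_(size (map p t)), [/\ i < j, i.+1 <> j,
      ~ (i = 0 :> nat /\ j.+1 = size (map p t)) & adj (nth (p z) (p z :: map p t) i) (nth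
        (p z) (p z :: map p t) j)].
    by apply: (@has_chordP _ _ (fun i => nth (p z) (p z :: map p t) i)) => //; exists i0,
      j0.
  have il := ltn_ord i; have jl := ltn_ord j.
  exists i, j; split=> //.
  - by lia.
  - by rewrite -sz.
  - by rewrite -!vE //; lia.
have {ij} [ij jt] : i < j /\ j < size t by lia.
have ijt : i <= j <= size t by lia.
have it : i <= size t by lia.
have wij := walk_sub ijt zt.
(* The chord is lifted at position [j]; the segment from [i] to [j] followed by this lift has length
   at most [r], so the lift ends at position [i]. *)
have [y jy py] := covering_lift cov (adj_sym a).
have wy : walk (nth z (z :: t) i) (drop i (take j t) ++ [:: y]) y by apply: walk_cat wij
  _.
have yi : nth z (z :: t) i = y.
  by apply: (short_walk_closed hp wy); rewrite ?py // size_cat ssz //=; lia.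
rewrite -{}yi {y py wy} in jy.
have wM : walk (nth z (z :: t) i) (drop i (take j t) ++ [:: nth z (z :: t) i]) (nth z (z
  :: t) i).
  by apply: walk_cat wij _.
have wC := walk_shortcut it (ltnW jt) (adj_sym jy) zt.
have := IH _ _ _ wM; have := IH _ _ _ wC.
rewrite !size_cat /= ssz // size_takel // size_drop => /(_ ltac:(lia) ltac:(lia)) C /(_
  ltac:(lia) ltac:(lia)) M.
move: C M; rewrite (parity_split f z ijt) !parity_cat (walk_last wij) lastE //= (fC (nth
  z (z :: t) j)).
by do 3 case: (parity _ _ _); case: (f _ _).
Qed.

Lemma cover_hole_free : hole_free [set: H].
Proof.
apply: link_hole_free => [|f fC f3]; first exact: neighbours_hole_free.
by apply: (short_cocycle hp fC); exact: short_parity.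
Qed.
End Chordal.
End Cover.

(** * Bottlenecks of chordal graphs *)

Lemma finite_card_lt (T : Type) (A C : set T) x : finite_set A -> A x -> C `<=` A ->
  ~ C x -> ~ (A #<= C)%card.
Proof.
move=> fA Ax CA Cx AC.
have /finite_setP[n An] : finite_set (A `\ x) by apply: sub_finite_set fA => z [].
have /card_eqPle[_ nA] : (A #= `I_n.+1)%card by apply/eq_cardSP; exists x.
have /card_eqPle[An' _] := An.
have : (`I_n.+1 #<= `I_n)%card.
  apply: card_le_trans nA (card_le_trans AC (card_le_trans _ An')).
  by apply: subset_card_le => z Cz; split; [exact: CA | move=> zx; apply: Cx; rewrite
    -zx].
by rewrite card_le_II ltnn.
Qed.

Section Cliques.
Variable G : graph.
Implicit Types (K X Y : set G).

Lemma clique_maximal K : clique K -> exists2 X, maximal_clique X & K `<=` X.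
Proof.
(* With [K] inside the predicate, the union of the empty chain is admissible too. *)
move=> Kc; have [|X [Xc Xmax]] := @Zorn_bigcup G [set X | clique (X `|` K)].
  move=> F FP tot x y; move=> [[X FX Xx]|Kx] [[Y FY Yy]|Ky] xy; last exact: Kc.
  - have [XY|YX] := tot X Y FX FY.
      by apply: (FP _ FY) => //; left => //; exact: XY.
    by apply: (FP _ FX) => //; left => //; exact: YX.
  - by apply: (FP _ FX) => //; [left|right].
  - by apply: (FP _ FY) => //; [right|left].
exists (X `|` K); last by right.
split=> // L Lc XKL; rewrite eqEsubset; split=> // y Ly.
left; apply: contrapT => Xy; apply: (Xmax L).
  by split=> [z Xz|/(_ _ Ly)] //; apply: XKL; left.
suff E : L `|` K = L by rewrite /= E.
by apply/setUidPl => z Kz; apply: XKL; right.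
Qed.

Lemma clique_finite K x : locally_finite G -> clique K -> K x -> finite_set K.
Proof.
move=> lf Kc Kx; apply: (@sub_finite_set _ _ (x |` neighbours x)) => [y Ky|].
  by have [->|yx] := pselect (y = x); [left | right; apply: Kc => // /esym].
by rewrite finite_setU; split; [exact: finite_set1 | exact: lf].
Qed.
End Cliques.

Section Separations.
Variable G : graph.
Implicit Types (a b : osep G) (s t : usep G) (X Y : set G).

Lemma unorient_flip a : unorient (flip a) = unorient a.
Proof. by rewrite /unorient /= setUC. Qed.

Lemma flipK a : flip (flip a) = a. Proof. by case: a. Qed.

Lemma unorient_inj a b : unorient a = unorient b -> b = a \/ b = flip a.
Proof.
case: a b => [A C] [A' C']; rewrite /unorient /flip /= => E.
have hA : A = A' \/ A = C' by change ([set A'; C'] A); rewrite -E; left.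
have hC : C = A' \/ C = C' by change ([set A'; C'] C); rewrite -E; right.
have hA' : A' = A \/ A' = C by change ([set A; C] A'); rewrite E; left.
have hC' : C' = A \/ C' = C by change ([set A; C] C'); rewrite E; right.
case: hA => hA; case: hC => hC; case: hA' => hA'; case: hC' => hC'; subst; first [by left
  | by right].
Qed.

Lemma separator_unorient a : separator (unorient a) = a.1 `&` a.2.
Proof.
rewrite eqEsubset; split=> [x h|x [h1 h2] C [->|->]] //.
by split; apply: h; [left|right].
Qed.

Lemma separation_unorient a : separation (unorient a) <->
  a.1 `|` a.2 = setT /\ forall x y, (a.1 `\` a.2) x -> (a.2 `\` a.1) y -> ~ adj x y.
Proof.
split=> [[b ba [bT bN]]|h]; last by exists a.
have [->//|->] := unorient_inj ba; split; first by rewrite setUC.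
by move=> x y ? ? /adj_sym; exact: bN.
Qed.

Lemma distinguishes_sym s X Y : distinguishes s X Y -> distinguishes s Y X.
Proof.
move=> [ss [a as_ [Xa Ya]]]; split=> //.
by exists (flip a); rewrite ?unorient_flip.
Qed.

Lemma efficiently_sym s X Y :
  efficiently_distinguishes s X Y -> efficiently_distinguishes s Y X.
Proof.
move=> [ds smin]; split; first exact: distinguishes_sym.
by move=> t /distinguishes_sym; exact: smin.
Qed.

(* [(~` F, Q)] is a separation with separator [far_boundary setT x y], which
   is a clique if [G] is chordal. *)
Section Far.
Variables (x y : G) (X Y : set G).
Hypotheses (xy : x <> y) (nxy : ~ adj x y).
Hypotheses (Xx : X x) (Xfar : far_boundary setT x y `<=` X).
Hypotheses (Yc : clique Y) (Yy : Y y).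

Let F := far setT x y.
Let Q := F `|` far_boundary setT x y.

Let Fx z : F z -> z <> x /\ ~ adj x z.
Proof. by move=> /conn_right [_ /not_orP[]]. Qed.

Let Fy : F y.
Proof. by apply: conn_refl; split=> // -[/esym|]. Qed.

Let YQ : Y `<=` Q.
Proof.
move=> z Yz; have [Fz|Fz] := pselect (F z); [by left | right].
have zy : z <> y by move=> E; apply: Fz; rewrite E.
apply: far_exit (Yc Yz Yy zy) Fy Fz; exact: I.
Qed.

Let Qx : ~ Q x.
Proof. by move=> [/Fx[]|[_ /adj_irrefl]]. Qed.

Let QF u w : ~ Q u -> F w -> ~ adj u w.
Proof.
move=> Qu Fw uw; apply: (Qu); right; apply: far_exit uw Fw _ => // Fu.
by apply: Qu; left.
Qed.

(** The corner of [a] with the separation given by the complement of [F] and [Q]. Its separator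
    keeps only vertices of [Q], which loses [x]. *)
Lemma far_distinguishes a : separation (unorient a) -> X `<=` a.1 -> Y `<=` a.2 ->
  exists2 t, distinguishes t X Y &
    separator t `<=` ((a.1 `&` a.2) `&` Q) `|` far_boundary setT x y `&` a.2.
Proof.
move=> /separation_unorient [aT aN] Xa Ya.
exists (unorient (a.1 `|` ~` F, a.2 `&` Q)).
  split; last first.
    exists (a.1 `|` ~` F, a.2 `&` Q) => //=; split=> z.
      by move=> /Xa; left.
    by move=> Yz; split; [exact: Ya | exact: YQ].
  apply/separation_unorient => /=; split.
    rewrite -subTset => z _; have [Fz|Fz] := pselect (F z); last by left; right.
    have : (a.1 `|` a.2) z by rewrite aT.
    by move=> [?|?]; [left; left | right; split=> //; left].
  move=> u w [_ /not_andP uQ] [[w2 Qw] /not_orP[w1 /contrapT Fw]].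
  case: uQ => u2; last exact: QF.
  apply: aN => //; split=> //.
  have : (a.1 `|` a.2) u by rewrite aT.
  by case.
rewrite separator_unorient /= => z [[z1|z1] [z2 Qz]]; first by left.
by right; case: Qz.
Qed.

(** Applied to the separation with sides [X] and [setT], the corner has a separator inside [X] that
    misses [x]; this makes the order smaller than the size of a finite [X]. *)
Lemma far_separates : exists2 t, distinguishes t X Y & separator t `<=` X `\ x.
Proof.
have sX : separation (unorient (X, setT)).
  by apply/separation_unorient; split=> [|u w [_ []]] //=; rewrite setUT.
have [t tXY tX] := far_distinguishes sX (@subset_refl _ X) (@subsetT _ Y).
exists t => // z /tX [[[Xz _] Qz]|[bz _]]; split=> //=.
- by move=> zx; apply: Qx; rewrite -zx.
- exact: Xfar.
- by case: bz => _ + _ zx; rewrite zx => /adj_irrefl.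
Qed.

(** If [x] were in [a.2], it would lie in the separator, and the corner would have a properly
    smaller separator, as the boundary is contained in [X] and hence in [a.1]. *)
Lemma efficient_avoids a : efficiently_distinguishes (unorient a) X Y ->
  finite_set (a.1 `&` a.2) -> X `<=` a.1 -> Y `<=` a.2 -> ~ a.2 x.
Proof.
move=> [[sa _] amin] fa Xa Ya x2.
have [t /amin st tX] := far_distinguishes sa Xa Ya.
move: st; rewrite separator_unorient.
apply: (@finite_card_lt _ _ _ x) => //.
- by split=> //; exact: Xa.
- by move=> z /tX [[]//|[/Xfar /Xa]].
- by move=> /tX [[_ /Qx]|[h _]] //; apply: Qx; right.
Qed.
End Far.
End Separations.

Lemma min_order (G : graph) (X Y : set G) t : distinguishes t X Y ->
  finite_set (separator t) -> exists k,
    (forall s, efficiently_distinguishes s X Y -> has_order s k) /\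
    forall s, distinguishes s X Y -> (`I_k #<= separator s)%card.
Proof.
move=> tXY /finite_setP[n tn].
have [|k [t0 t0XY t0k] kmin] := @min_nat (fun k => exists2 t, distinguishes t X Y &
  has_order t k) n.
  by exists t.
have le s : distinguishes s X Y -> (`I_k #<= separator s)%card.
  move=> sXY; have [/finite_setP[j sj]|] := pselect (finite_set (separator s)); last
    first.
    move=> /infiniteP h; apply: card_le_trans h; exact: subset_card_le.
  have kj : k <= j by apply: kmin; exists s.
  by rewrite (card_le_eqr sj) card_le_II.
exists k; split=> // s [sXY smin]; apply/card_eqPle; split; last exact: le.
by rewrite -(card_le_eqr t0k); exact: smin.
Qed.

Section ChordalTree.
Variables (B : bottleneck_notion) (hB : bottleneck_axioms B) (G : graph).
Hypotheses (lf : locally_finite G) (conG : connected G) (ch : hole_free [set: G]).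

Lemma node_orient (N : set (usep G)) (t : model (tree_of N)) s : N s ->
  exists2 a, unorient a = s & bag (tree_of N) t `<=` a.2.
Proof.
case: t => sigma [O [[ON NO] Oc Om E]] Ns /=; subst sigma.
have [a [[Oa as_] _]] := NO _ Ns; exists a => // x xt.
by have [b bm [_ ba]] := Om _ Oa; apply: ba; exact: xt.
Qed.

Lemma card_lt_I (T : Type) (C D : set T) x k m : finite_set D -> D x ->
  C `<=` D `\ x -> (`I_k #<= C)%card -> (D #= `I_m)%card -> k < m.
Proof.
move=> fD Dx CD kC Dm; rewrite ltnNge; apply/negP => mk.
have CD' : C `<=` D by move=> z /CD [].
have Cx : ~ C x by move=> /CD [_]; apply.
apply: (finite_card_lt fD Dx CD' Cx).
by rewrite (card_le_eql Dm); apply: card_le_trans kC; rewrite card_le_II.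
Qed.

(** For non-adjacent [x] and [y] in a bag, let [X] be a maximal clique containing [x] and the
    boundary towards [y], and [Y] symmetrically. Their bottleneck contributes some [s] to [N_all];
    by efficiency [x] and [y] lie strictly on different sides of [s], while a bag lies within one
    side. *)
Lemma hole_free_tree_cliques : into_cliques (bottleneck_tree B G).
Proof.
move=> t x y xt yt xy; apply: contrapT => nxy.
have nyx : ~ adj y x by move=> /adj_sym.
have yx : y <> x by move/esym.
have cl (u v : G) : clique (u |` far_boundary setT u v).
  have bc := far_boundary_clique ch (u := u) (y := v) I.
  move=> a b [->|[_ ua h]] [->|[_ ub h']] // ab; first exact: adj_sym.
  by apply: bc.
have [X Xm Xfar] := clique_maximal (cl x y).
have [Y Ym Yfar] := clique_maximal (cl y x).
have [Xc _] := Xm; have [Yc _] := Ym.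
have Xx : X x by apply: Xfar; left.
have Yy : Y y by apply: Yfar; left.
have {}Xfar : far_boundary setT x y `<=` X by move=> z ?; apply: Xfar; right.
have {}Yfar : far_boundary setT y x `<=` Y by move=> z ?; apply: Yfar; right.
have XY : X <> Y by move=> E; apply: nxy; apply: Xc => //; rewrite E.
have fX := clique_finite lf Xc Xx; have fY := clique_finite lf Yc Yy.
have [/finite_setP[m Xm'] /finite_setP[n Yn]] := (fX, fY).
have [t1 t1XY t1X] := far_separates xy nxy Xfar Yc Yy.
have [t2 /distinguishes_sym t2XY t2Y] := far_separates yx nyx Yfar Xc Xx.
have [|k [ek mk]] := min_order t1XY.
  by apply: sub_finite_set fX => z /t1X [].
have kmn : k < minn m n.
  by rewrite leq_min (card_lt_I fX Xx t1X (mk _ t1XY) Xm') (card_lt_I fY Yy t2Y (mk _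
    t2XY) Yn).
have chG : chordal G by move=> j c j3 cyc; apply: ch.
have beta := bottleneck_chordal hB lf chG Xm Ym XY ek Xm' Yn kmn.
have [s sN] := N_bottleneck_nonempty hB lf conG beta.
have [[seff _] _] := sN.
have sk := ek _ seff.
have Ns : N_all B s by exists k => //; exists [set s | efficiently_distinguishes s X Y].
have [a as_ ta] := node_orient t Ns.
have [[_ [b bs [Xb Yb]]] _] := seff.
have fb : finite_set (b.1 `&` b.2).
  by rewrite -separator_unorient bs; apply/finite_setP; exists k.
rewrite -bs in seff.
have b2 := efficient_avoids xy nxy Xx Xfar Yc Yy seff fb Xb Yb.
rewrite setIC in fb.
have b1 : ~ b.1 y.
  apply: (efficient_avoids yx nyx Yy Yfar Xc Xx (a := flip b)) => //.
  by rewrite unorient_flip; exact: efficiently_sym.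
have [E|E] := unorient_inj (etrans bs (esym as_)).
- by apply: b2; rewrite -E; exact: ta.
- by apply: b1; rewrite -[b.1]/(flip b).2 -E; exact: ta.
Qed.
End ChordalTree.

(** * Trees of nested sets *)

Lemma ole_flip (G : graph) (a b : osep G) : ole (flip a) (flip b) <-> ole b a.
Proof. by split=> -[]. Qed.

Lemma ole_anti (G : graph) (a b : osep G) : ole a b -> ole b a -> a = b.
Proof.
by case: a b => [A C] [A' C'] [/= AA CC] [/= AA' CC']; congr (_, _); rewrite eqEsubset.
Qed.

Section Nodes.
Variables (G : graph) (N : set (usep G)).
Hypotheses (Nn : nested_set N) (Nt : forall s, N s -> tight s).
Implicit Types (t u : node N) (a b c : osep G).

Definition node_orientation t : set (osep G) := sval (cid (svalP t)).
Local Notation ori := node_orientation.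

Lemma node_orientationP t : [/\ orientation N (ori t), consistent (ori t),
  forall a, ori t a -> exists2 b, maximal_elements (ori t) b & ole a b &
  sval t = maximal_elements (ori t)].
Proof. exact: svalP (cid (svalP t)). Qed.

Lemma ori_N t a : ori t a -> N (unorient a).
Proof. by have [[h _] _ _ _] := node_orientationP t; exact: h. Qed.

Lemma ori_total t a : N (unorient a) -> ori t a \/ ori t (flip a).
Proof.
have [[_ h] _ _ _] := node_orientationP t => /h [b [[tb ba] _]].
by have [<-|<-] := unorient_inj (esym ba); [left | right].
Qed.

Lemma ori_inj t a b : ori t a -> ori t b -> unorient a = unorient b -> a = b.
Proof.
move=> ta tb ab; have [[_ h] _ _ _] := node_orientationP t.
have [c [_ cU]] := h _ (ori_N ta).
by rewrite -(cU a) // -(cU b).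
Qed.

Lemma ori_max t a : sval t a -> ori t a /\ forall b, ori t b -> ole a b -> b = a.
Proof. by have [_ _ _ ->] := node_orientationP t. Qed.

Lemma ori_bag t a : ori t a -> bag (tree_of N) t `<=` a.2.
Proof.
have [_ _ h E] := node_orientationP t => /h [b bm [_ ba]] x xt.
by apply/ba/xt; rewrite E.
Qed.

Lemma tight_proper a : N (unorient a) -> exists2 x, a.1 x & ~ a.2 x.
Proof.
move=> /Nt [_ /(_ _ erefl) [C [[_ [[x] _] _] Ca _]]].
by have [? ?] := Ca _ (svalP x); exists (sval x).
Qed.

(** Nestedness makes some orientations comparable; maximality of [a] and consistency leave only
    these two cases. *)
Lemma ori_compare t a c : sval t a -> ori t c -> unorient c <> unorient a ->
  ole c a \/ ole c (flip a).
Proof.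
move=> /ori_max [ta amax] tc ca.
have [_ con _ _] := node_orientationP t.
have [a' [c' [/esym /unorient_inj aa /esym /unorient_inj cc]]] := Nn (ori_N ta) (ori_N
  tc).
have nac : ~ ole a c by move=> /(amax _ tc) E; apply: ca; rewrite E.
have n1 : ~ ole (flip a) c by apply: con => // /esym.
have n2 : ~ ole (flip c) a by exact: con.
have e1 : ole a (flip c) -> ole c (flip a) by case.
by case: aa => ->; case: cc => -> []; rewrite ?ole_flip; tauto.
Qed.

(** Any other maximal element lies below [flip a], so its second side contains [a.1]. *)
Lemma separator_sub_bag t a : sval t a -> a.1 `&` a.2 `<=` bag (tree_of N) t.
Proof.
move=> ta x [x1 x2] /= b tb; have [oa _] := ori_max ta; have [ob bmax] := ori_max tb.
have [ba|ba] := pselect (unorient b = unorient a).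
  by rewrite (ori_inj ob oa ba).
case: (ori_compare ta ob ba) => [/(bmax _ oa) E|[_]]; last exact.
by case: ba; rewrite E.
Qed.

Lemma bag_exit t x : ~ bag (tree_of N) t x -> exists a, [/\ sval t a, a.1 x & ~ a.2 x].
Proof.
rewrite /= => /existsNP [a /not_implyP [ta x2]]; exists a; split=> //.
have [oa _] := ori_max ta; have [sa _] := Nt (ori_N oa).
have [aT _] := (separation_unorient a).1 sa.
have : (a.1 `|` a.2) x by rewrite aT.
by case.
Qed.

(** Otherwise [c] and [flip c] would each lie below an orientation of [a]: below the same one, that
    orientation has the whole vertex set as its first side, against tightness; below opposite ones,
    [c] is an orientation of [a]. *)
Lemma ori_agree t u a c : sval t a -> sval u a \/ sval u (flip a) ->
  ori t c -> unorient c <> unorient a -> ori u c.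
Proof.
move=> ta ua tc ca; have [//|uc] := ori_total u (ori_N tc); exfalso.
have Na : N (unorient a) by apply: ori_N (ori_max ta).1.
have [aT _] := (separation_unorient a).1 (Nt Na).1.
have [cT _] := (separation_unorient c).1 (Nt (ori_N tc)).1.
have [x a1 a2] := tight_proper Na.
have Nfa : N (unorient (flip a)) by rewrite unorient_flip.
have [y b2 b1] := tight_proper Nfa.
have h : ole (flip c) a \/ ole (flip c) (flip a).
  case: ua => ua.
    by apply: (ori_compare ua uc); rewrite unorient_flip.
  by rewrite or_comm -{2}[a]flipK; apply: (ori_compare ua uc); rewrite !unorient_flip.
case: (ori_compare ta tc ca) => h1; case: h => h2.
- have : (c.1 `|` c.2) y by rewrite cT.
  by case: h1 h2 => [h1 _] [h2 _] [/h1|/h2].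
- by apply: ca; rewrite (ole_anti h1 _) //; apply/ole_flip.
- apply: ca; rewrite (ole_anti h1 _) ?unorient_flip //.
  by apply/ole_flip; rewrite flipK.
- have : (c.1 `|` c.2) x by rewrite cT.
  by case: h1 h2 => [h1 _] [h2 _] [/h1|/h2].
Qed.

Lemma node_uniq t u a : sval t a -> sval u a -> t = u.
Proof.
move=> ta ua; apply: sval_inj.
have [_ _ _ ->] := node_orientationP t; have [_ _ _ ->] := node_orientationP u.
congr maximal_elements; rewrite eqEsubset; split=> c oc.
  have [ca|ca] := pselect (unorient c = unorient a).
    by rewrite (ori_inj oc (ori_max ta).1 ca); exact: (ori_max ua).1.
  by apply: (ori_agree ta _ oc ca); left.
have [ca|ca] := pselect (unorient c = unorient a).
  by rewrite (ori_inj oc (ori_max ua).1 ca); exact: (ori_max ta).1.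
by apply: (ori_agree ua _ oc ca); left.
Qed.

Local Notation T := (model (tree_of N)).

(** By [ori_agree], a step of the walk can only reorient the separation it crosses; where [a]
    becomes oriented, the new node contains [a] and is therefore [s]. *)
Lemma walk_flip (t u s : T) w a : sval s a -> walk t w u -> ~ ori t a -> ori u a ->
  exists2 w', walk s w' u & size w' < size w.
Proof.
move=> sa; elim: w t => [|t' w IH] t /=; first by move=> ->.
move=> [[_ [b [Nb tb t'b]]] tu] ta ua.
have [ta'|ta'] := pselect (ori t' a); last first.
  by have [w' sw ww] := IH _ tu ta' ua; exists w' => //; exact: leqW.
exists w => //; suff -> : s = t' by [].
apply: (node_uniq sa).
have [E|ab] := pselect (unorient a = unorient b); last first.
  case: ta; apply: (ori_agree t'b _ ta'); first by right; rewrite flipK.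
  by rewrite unorient_flip.
have [E'|E'] := unorient_inj E; last by move: t'b; rewrite E' flipK.
by case: ta; rewrite -E'; exact: (ori_max tb).1.
Qed.

Hypothesis cliques : into_cliques (tree_of N).

(** Follow the walk until [x] leaves the bag. The separation crossed there works unless [u] lies
    behind it; in that case the walk returns to [t] and can be shortened. *)
Lemma tree_separates (t u : T) w x y : walk t w u -> bag (tree_of N) t x ->
  bag (tree_of N) u y -> x <> y -> ~ adj x y ->
  exists a, [/\ N (unorient a), clique (a.1 `&` a.2), a.2 x, ~ a.1 x & a.1 y /\ ~ a.2 y].
Proof.
move=> tu xt yu xy nxy; move: {2}(size w).+1 (ltnSn (size w)) => n.
elim: n t w tu xt => // n IH t [|t1 w] /= tu xt wn.
  by case: nxy; apply: (@cliques u) => //; rewrite -tu.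
have [[_ [a [Na ta t1a]]] t1u] := tu.
have [xt1|xt1] := pselect (bag (tree_of N) t1 x); first exact: (IH t1 w).
have x2 : a.2 x by apply: (ori_bag (ori_max ta).1).
have x1 : ~ a.1 x.
  by move=> x1; apply: xt1; apply: (separator_sub_bag t1a).
have [ua|ua] := ori_total u Na.
  have [|w' tw' ww] := walk_flip ta t1u _ ua; last first.
    by apply: (IH t w') => //; exact: (leq_trans ww (ltnW wn)).
  move=> ha; have [x' a1 a2] := tight_proper Na.
  have E := ori_inj ha (ori_max t1a).1 (esym (unorient_flip a)).
  by apply: a2; rewrite E.
exists a; split=> //.
  by move=> v z /(separator_sub_bag ta) vt /(separator_sub_bag ta) zt; exact: (@cliques
    t).
split; first exact: (ori_bag ua).
move=> y2; apply: nxy; apply: (@cliques t) => //.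
by apply: (separator_sub_bag ta); split=> //; apply: (ori_bag ua).
Qed.

(** If [c i0] and [c i2] are not adjacent, a clique separator lies strictly between them. Both arcs
    of the cycle meet it, one in [c i1] and the other in some [c k], and these two span a chord. *)
Lemma tree_cliques_hole_free : tree_decomposition (tree_of N) -> hole_free [set: G].
Proof.
move=> [[[_ conT] _] cover _ _] n c n3 _ cyc; have [n2 cinj cadj] := cyc.
have l0 : 0 < n by lia.
have l1 : 1 < n by lia.
have m1 : n - 1 < n by lia.
pose i0 := Ordinal l0; pose i1 := Ordinal l1; pose i2 := Ordinal n2; pose il := Ordinal
  m1.
have chord (i j : 'I_n) : i < j -> i.+1 <> j -> ~ (i = 0 :> nat /\ j.+1 = n) ->
    adj (c i) (c j) -> has_chord c.
  by move=> ij ij1 w a; have [? ?] := ordS_neq ij ij1 w; exists i, j.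
have [a|nxy] := pselect (adj (c i0) (c i2)); first by apply: (chord i0 i2) => //=; lia.
have xy : c i0 <> c i2 by move=> /cinj /(congr1 val).
have nx (i j : 'I_n) : j = i.+1 %% n :> nat -> adj (c i) (c j).
  by move=> E; have := cadj i; congr (adj _ (c _)); apply: val_inj.
have a01 : adj (c i0) (c i1) by apply: nx; rewrite /= modn_small.
have a12 : adj (c i1) (c i2) by apply: nx; rewrite /= modn_small.
have al0 : adj (c il) (c i0) by apply: nx; rewrite /= subn1 prednK ?modnn.
have [t xt] := cover (c i0); have [u yu] := cover (c i2); have [w tu] := conT t u.
have [a [Na ac x2 x1 [y1 y2]]] := tree_separates tu xt yu xy nxy.
have [aT aN] := (separation_unorient a).1 (Nt Na).1.
have a12T v : ~ a.1 v -> a.2 v.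
  by move=> v1; have [] : (a.1 `|` a.2) v by rewrite aT.
have a21T v : ~ a.2 v -> a.1 v.
  by move=> v1; have [] : (a.1 `|` a.2) v by rewrite aT.
have sep1 : (a.1 `&` a.2) (c i1).
  split.
    by apply: contrapT => h; apply: (aN (c i2) (c i1)) => //; [split=> //; exact: a12T |
      exact: adj_sym].
  by apply: contrapT => h; apply: (aN (c i1) (c i0)) => //; [split=> //; exact: a21T |
    exact: adj_sym].
have [k k2 sepk] : exists2 k : 'I_n, 2 < k & (a.1 `&` a.2) (c k).
  have cc : conn [set v | exists2 k : 'I_n, 2 <= k & c k = v] (c i2) (c il).
    apply: cycle_conn cyc _ _ => /= [|k /andP[k2 _]]; first by lia.
    by exists k.
  have nl : ~ (a.1 `\` a.2) (c il) by move=> h; apply: (aN _ _ h _ al0).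
  have [z [v [[z1 z2] nv zv [_ [k k2 kv]]]]] := conn_exit cc (conj y1 y2) nl.
  have v1 : a.1 v by apply: contrapT => h; apply: (aN z v) => //; split=> //; exact: a12T.
  have v2 : a.2 v by apply: contrapT => h; exact: nv.
  exists k; last by rewrite kv.
  rewrite ltn_neqAle k2 andbT; apply/eqP => E.
  by apply: nv; rewrite -kv (_ : k = i2) //; apply: val_inj.
apply: (chord i1 k) => //=; [lia|lia|lia|].
by apply: ac => // /cinj /(congr1 val) /= E; move: k2; rewrite -E.
Qed.
End Nodes.

(** * Bags with complete projections *)

Section Projection.
Variables (r : nat) (H G : graph) (p : H -> G).
Hypotheses (hp : local_covering r p) (r3 : 2 < r).

Let cov : covering p. Proof. exact: local_covering_covering hp. Qed.

(** Neighbours of [y] with the same image coincide, and with adjacent images they are adjacent by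
    [lift_triangle]. *)
Lemma clique_lift_trans (S : set H) x y z : clique (p @` S) -> S x -> S z ->
  x <> z -> x = y \/ adj x y -> y = z \/ adj y z -> adj x z.
Proof.
move=> Sc Sx Sz xz [<-|xy] [yz|yz] //; first by rewrite -yz.
have [E|E] := pselect (p x = p z).
  by case: xz; apply: (covering_inj cov (adj_sym xy) yz).
apply: (lift_triangle hp r3 (adj_sym xy) yz); apply: Sc E; [by exists x|by exists z].
Qed.

Section Separator.
Variable a : osep H.
Hypotheses (ta : tight (unorient a)) (pa : clique (p @` (a.1 `&` a.2))).

Let X := a.1 `&` a.2.

Let star x : set H := [set k | X k /\ (k = x \/ adj x k)].

(** The images of [k] and [q] are equal or adjacent. Lifting that edge extends the walk to length at
    most [r], so [k] and [q] are themselves equal or adjacent, and [clique_lift_trans] gives the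
    claim. *)
Lemma star_closed x k u q : X x -> star x k -> walk k u q -> size u < r -> X q ->
  star x q.
Proof.
move=> Xx [Xk kx] ku ur Xq; split=> //.
have kq : k = q \/ adj k q.
  have [E|E] := pselect (p k = p q).
    by left; apply: (short_walk_closed hp ku (ltnW ur) E).
  have : adj (p q) (p k) by apply/adj_sym/pa.
  move=> /(covering_lift cov) [y qy py]; right; apply: adj_sym.
  have wy : walk k (u ++ [:: y]) y by apply: walk_cat ku _.
  by rewrite (short_walk_closed hp wy) ?py // size_cat addn1.
have [qx|qx] := pselect (q = x); [by left | right].
have xk : x = k \/ adj x k by case: kx => [->|]; [left | right].
by apply: (clique_lift_trans pa Xx Xq _ xk kq) => /esym.
Qed.

Lemma separator_star x y : X x -> X y -> star x y.
Proof.
move=> Xx Xy; have := ta; rewrite /tight separator_unorient -/X => -[_ tC].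
have [C1 [[C1X conC1 _] C1a NC1]] := tC _ erefl.
have [C2 [[C2X conC2 _] C2a NC2]] := tC _ (unorient_flip a).
have C12 v : C1 v -> ~ C2 v by move=> /C1a [v1 _] /C2a [].
pose g v := `[<C1 v>]; pose k v := `[<star x v>].
(* The labelled edges join [C1] to the star of [x]. *)
pose f u v := g u && k v || g v && k u.
have fC u v : f u v = f v u by rewrite /f orbC.
have gF v : ~ C1 v -> g v = false by move=> ?; exact: asboolF.
have gX v : X v -> g v = false by move=> Xv; apply: gF => /C1X.
have kF v : ~ X v -> k v = false by move=> ?; apply: asboolF => -[].
have C1N u v : C1 u -> ~ C1 v -> adj u v -> X v.
  by move=> uC vC uv; rewrite -NC1; split=> //; exists u.
have short z t : walk z t z -> size t <= r -> parity f z t = false.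
  move=> zt tr.
  have [[i [it ki]]|nk] := pselect (exists i, i <= size t /\ star x (nth z (z :: t) i));
    last first.
    rewrite (@parity_coboundary _ f (fun=> false) (~` star x) _ _ _ _ zt) //.
      by move=> u v ku kv _; rewrite /f /k !asboolF //= !andbF.
    by move=> i it ki; apply: nk; exists i.
  (* Once a short closed walk meets the star, all its vertices in [X] belong to the star, and [f] is
     the coboundary of the indicator of [C1] along it. *)
  rewrite (@parity_coboundary _ f g (~` (X `\` star x)) _ _ _ _ zt) ?addbb //.
    move=> u v /not_andP Xu /not_andP Xv uv; rewrite /f.
    have [Cu|Cu] := pselect (C1 u); have [Cv|Cv] := pselect (C1 v).
    - by rewrite /g !asboolT // !kF // => /C1X.
    - rewrite (gF _ Cv) /g asboolT //= orbF; apply: asboolT.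
      by case: Xv => [[]|/contrapT //]; exact: C1N Cu Cv uv.
    - rewrite (gF _ Cu) /g asboolT //=; apply: asboolT.
      by case: Xu => [[]|/contrapT //]; exact: C1N Cv Cu (adj_sym uv).
    - by rewrite !gF.
  move=> j jt [Xj]; apply.
  have [ij|ji] := leqP i j.
    have ijt : i <= j <= size t by rewrite ij.
    (* A walk of full length [r] is too long for [star_closed]; then [i] and [j] are its two ends,
       which coincide. *)
    have [E|E] := eqVneq (j - i) (size t).
      have -> : nth z (z :: t) j = nth z (z :: t) i; last by [].
      have [-> ->] : i = 0 /\ j = size t by lia.
      exact: nth_walk_size.
    apply: star_closed (walk_sub ijt zt) _ Xj => //.
    by rewrite size_drop size_takel //; lia.
  have jit : j <= i <= size t by rewrite ltnW.
  have [E|E] := eqVneq (i - j) (size t).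
    have -> : nth z (z :: t) j = nth z (z :: t) i; last by [].
    have [-> ->] : j = 0 /\ i = size t by lia.
    exact/esym/nth_walk_size.
  apply: star_closed (walk_rev (walk_sub jit zt)) _ Xj => //.
  by rewrite size_rev_walk size_drop size_takel //; lia.
have via C : connected (induced C) -> neighbourhood C = X -> forall u v, X u -> X v ->
    exists c s d, [/\ C c, adj u c, walk c s d, (forall i, i <= size s -> C (nth c (c ::
      s) i)) & adj d v].
  move=> [_ con] NC u v; rewrite -NC => -[_ [c Cc cu]] [_ [d Cd dv]].
  have [s0 cd] := con (exist _ c Cc) (exist _ d Cd).
  have [s cs sC] := conn_walk (walk_induced cd).
  by exists c, s, d; split=> //; exact: adj_sym.
have [c1 [s1 [d1 [Cc1 xc1 w1 s1C d1y]]]] := via _ conC1 NC1 _ _ Xx Xy.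
have [c2 [s2 [d2 [Cc2 yc2 w2 s2C d2x]]]] := via _ conC2 NC2 _ _ Xy Xx.
have Cd1 : C1 d1 by rewrite -(nth_walk_size w1); exact: s1C.
have Cd2 : C2 d2 by rewrite -(nth_walk_size w2); exact: s2C.
apply: contrapT => nky.
(* The walk goes from [x] through [C1] to [y] and back through [C2]; if [y] is outside the star,
   only its first edge is labelled. *)
have w : walk x ((c1 :: s1) ++ (y :: c2 :: s2) ++ [:: x]) x.
  apply: walk_cat (_ : walk x (c1 :: s1) d1) _ => //.
  by apply: walk_cat (_ : walk d1 (y :: c2 :: s2) d2) _.
have := short_cocycle hp fC short w.
rewrite !parity_cat /= (walk_last w1) (walk_last w2).
rewrite (@parity_coboundary _ f (fun=> false) C1 _ _ _ _ w1 s1C); last first.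
  by move=> u v uC vC _; rewrite /f !kF ?andbF //; exact: C1X.
rewrite (@parity_coboundary _ f (fun=> false) C2 _ _ _ _ w2 s2C); last first.
  by move=> u v uC vC _; rewrite /f !gF // => /C12.
have -> : f x c1 = true.
  have kx : k x = true by apply: asboolT; split=> //; left.
  by rewrite /f kx /g (asboolT Cc1) orbT.
have -> : f d1 y = false.
  by rewrite /f (gX _ Xy) /k (asboolF nky) andbF.
have -> : f y c2 = false by rewrite /f (gX _ Xy) gF // => /C12.
have -> : f d2 x = false by rewrite /f (gX _ Xx) gF // => /C12.
by [].
Qed.

Lemma separator_clique : clique X.
Proof.
by move=> x y Xx Xy xy; have [_ []] := separator_star Xx Xy => // E; case: xy.
Qed.
End Separator.

(** An excursion from the bag leaves and returns through one separator, which is a clique, so the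
    bag is connected. Along a path inside the bag, [clique_lift_trans] makes all pairs adjacent. *)
Lemma bag_clique (N : set (usep H)) (t : node N) : connected H -> nested_set N ->
  (forall s, N s -> tight s) -> clique (p @` bag (tree_of N) t) ->
  clique (bag (tree_of N) t).
Proof.
move=> [_ conH] Nn Nt; set V := bag (tree_of N) t => pV x y Vx Vy xy.
have [s xs] := conH x y.
have : conn (setT `&` V) x y.
  apply: conn_shortcut (walk_conn xs) => // x0 e w y0 _ Vx0 _ Vy0 x0e ew wy0.
  have [_ Ve] := conn_left ew.
  have [a [ta e1 e2]] := bag_exit Nt Ve.
  have Na := ori_N (ori_max ta).1; have sep := separator_sub_bag Nn ta.
  have [aT aN] := (separation_unorient a).1 (Nt _ Na).1.
  have in1 u v : a.1 u -> ~ a.2 u -> adj u v -> a.1 v.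
    move=> u1 u2 uv; apply: contrapT => v1; apply: (aN u v) => //; split=> //.
    by have [] : (a.1 `|` a.2) v by rewrite aT.
  (* The excursion stays strictly on its side of [a], since the separator lies in the bag. *)
  have [w1 w2] : a.1 w /\ ~ a.2 w.
    elim: ew e1 e2 {wy0 x0e Ve} => {e w} // u v z _ uv vz IH u1 u2.
    have v1 := in1 _ _ u1 u2 uv; apply: IH => // v2.
    by have [_] := conn_left vz; apply; apply: sep.
  have V2 := ori_bag (ori_max ta).1.
  have [|xy0] := pselect (x0 = y0); [by left | right].
  apply: (separator_clique (Nt _ Na) _ _ _ xy0).
  - by move=> _ _ [u /sep Vu <-] [v /sep Vv <-] uv; exact: pV.
  - by split; [exact: in1 e1 e2 (adj_sym x0e) | exact: V2].
  - by split; [exact: in1 w1 w2 wy0 | exact: V2].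
rewrite setTI => c; suff [//|] : x = y \/ adj x y by [].
elim: c Vy {xs xy Vx} => {x y} [x|x y z Vx xy yz IH] Vz; first by left.
have [|xz] := pselect (x = z); [by left | right].
by apply: (clique_lift_trans pV Vx Vz xz (or_intror xy) (IH Vz)).
Qed.

End Projection.

(** * Balls of the base graph *)

Lemma walk_conn_in (G : graph) (P : set G) (x y : G) s : walk x s y ->
  (forall i, i <= size s -> P (nth x (x :: s) i)) -> conn P x y.
Proof.
elim: s x => [|z s IH] x /=; first by move=> <- Ps; apply: conn_refl; exact: (Ps 0).
move=> [xz zs] Ps; apply: conn_step (Ps 0 isT) xz _; apply: IH => // i ils.
by have := Ps i.+1 ils; rewrite /= (@set_nth_default _ (z :: s) z x).
Qed.

Lemma val_ordS n (i : 'I_n) : ordS i = (if i.+1 == n then 0 else i.+1) :> nat.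
Proof.
rewrite /=; case: eqVneq => [->|ni]; first exact: modnn.
by rewrite modn_small // ltn_neqAle ni ltn_ord.
Qed.

(* Shortest walks from [x] and [y] to [v] meet no other neighbour of [u], so
   that otherwise they would close a hole through [u]. *)
Lemma closer_neighbours (G : graph) (v u x y : G) m s t : hole_free [set: G] ->
  is_dist v u m -> adj u x -> adj u y -> walk v s x -> walk v t y ->
  size s < m -> size t < m -> x = y \/ adj x y.
Proof.
move=> ch [_ um] ux uy vs vt sm tm.
(* Vertices at distance less than [m - 1] from [v], too close to be adjacent to [u]. *)
pose Z : set G := [set z | exists2 w, walk v w z & (size w).+1 < m].
have Zu z : Z z -> z <> u /\ ~ adj u z.
  move=> [w vw wm]; split=> [E|uz].
    by have := um w; rewrite -E => /(_ vw); lia.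
  have vwu : walk v (w ++ [:: u]) u by apply: walk_cat vw _; split=> //; exact: adj_sym.
  by have := um _ vwu; rewrite size_cat addn1; lia.
have end_ w z : walk v w z -> adj u z -> size w < m -> z = v \/
    exists2 e, adj e z & conn Z v e.
  elim/last_ind: w => [|w z' _]; first by left.
  move=> vw uz; rewrite size_rcons -cats1 in vw * => wm.
  have [vl /= [lz zz]] := walk_catI vw; subst z'.
  right; exists (last v w) => //; apply: walk_conn_in (vl) _ => i iw.
  exists (take i w); first exact: walk_take iw vl.
  by rewrite size_takel //; lia.
have [Ex|[e ex ve]] := end_ _ _ vs ux sm; have [Ey|[e' ey ve']] := end_ _ _ vt uy tm.
- by left; rewrite Ex Ey.
- by have [_] := Zu _ (conn_left ve'); rewrite -Ex.
- by have [_] := Zu _ (conn_left ve); rewrite -Ey.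
apply: (hole_free_adj ch I I I ux uy (adj_sym ex) _ ey (Z := Z)) => //.
exact: conn_trans (conn_sym ve) ve'.
Qed.

Section Descent.
Variables (r : nat) (H G : graph) (p : H -> G).
Hypotheses (hp : local_covering r p) (r3 : 2 < r).

Let cov : covering p. Proof. exact: local_covering_covering hp. Qed.

(** A cycle in a ball lifts along shortest walks from the centre, as adjacent vertices close a walk
    of length at most [r]. A chord of the lift projects to an edge of [G]; it remains to find one
    whose image is an edge of the ball. *)
Lemma cover_locally_chordal : hole_free [set: H] -> locally_chordal r G.
Proof.
move=> ch v n c n3 [n2 cinj cadj].
have [surj _ _] := cov; have [v' _ pv] := surj v I.
have lifts i : exists mh : nat * H, [/\ is_dist v (sval (c i)) mh.1, mh.1.*2 <= r,
    p mh.2 = sval (c i) & exists2 t, walk v' t mh.2 & size t = mh.1].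
  have [m dm mr] := svalP (c i); have [[s vs sm] _] := dm.
  have vs' : walk (p v') s (sval (c i)) by rewrite pv.
  have [t [h [vt ts ph]]] := walk_lift cov vs'.
  exists (m, h); split=> //; exists t => //.
  by rewrite -sm -ts size_map.
have [mh /= mhP] := choice lifts.
pose m i := (mh i).1; pose h i := (mh i).2.
have dm i : is_dist v (sval (c i)) (m i) by case: (mhP i).
have mr i : (m i).*2 <= r by case: (mhP i).
have ph i : p (h i) = sval (c i) by case: (mhP i).
have wh i : exists2 t, walk v' t (h i) & size t = m i by case: (mhP i).
have mm i : m i + m (ordS i) + 1 <= r.
  have [_ [m1 [m2 [d1 d2 m12]]]] := cadj i.
  by rewrite (is_dist_uniq (dm i) d1) (is_dist_uniq (dm (ordS i)) d2).
have cyc : is_cycle h.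
  split=> // [i j E|i].
    by apply/cinj/sval_inj; rewrite -!ph E.
  have [a _] := cadj i; rewrite -!ph in a.
  have [y hy py] := covering_lift cov a.
  have [t1 w1 s1] := wh i; have [t2 w2 s2] := wh (ordS i).
  have w : walk (h (ordS i)) (rev_walk v' t2 ++ t1 ++ [:: y]) y.
    by apply: walk_cat (walk_rev w2) _; apply: walk_cat w1 _.
  rewrite (short_walk_closed hp w) ?py // !size_cat size_rev_walk s1 s2 /=.
  by have := mm i; lia.
have badj i j : adj (h i) (h j) -> m i + m j + 1 <= r -> adj (c i) (c j).
  move=> a mij; split; last by exists (m i), (m j).
  by rewrite -!ph; exact: covering_adj.
(* If all distances are strictly below [r / 2], every chord satisfies the edge condition of the
   ball. *)
have [[j jr]|nj] := pselect (exists j, r <= (m j).*2); last first.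
  have small i : (m i).*2 < r by rewrite ltnNge; apply/negP => ?; apply: nj; exists i.
  have [i [j [a ji ij]]] := ch _ h n3 (fun=> I) cyc.
  by exists i, j; split=> //; apply: badj a _; have := small i; have := small j; lia.
(* Otherwise [h j] has distance exactly [r / 2], so its two neighbours on the cycle are closer to
   the centre and span the chord. *)
pose i := ord_pred j; pose k := ordS j.
have ij : ordS i = j by exact: ord_predK.
have mi := mm i; have mk := mm j; rewrite ij -/k in mi mk.
have mjr := mr j.
have [_ _ hadj] := cyc.
have ji : adj (h j) (h i) by rewrite -{1}ij; apply: adj_sym.
have jk : adj (h j) (h k) by exact: hadj.
have dj : is_dist v' (h j) (m j).
  split=> // s vs; have [_ jm] := dm j; have := walk_map cov vs.
  by rewrite pv ph => /jm; rewrite size_map.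
have [t1 w1 s1] := wh i; have [t2 w2 s2] := wh k.
have [||ik|ik] := closer_neighbours ch dj ji jk w1 w2; rewrite ?s1 ?s2; try lia.
  have [_ hinj _] := cyc; have /(congr1 (@nat_of_ord n)) := hinj _ _ ik.
  rewrite /k -ij val_ordS [X in X.+1]val_ordS; do 2 case: ifP; lia.
exists i, k; split.
- by apply: badj ik _; lia.
- rewrite ij => /(congr1 (@nat_of_ord n)); rewrite val_ordS; case: ifP => /=; lia.
- by move=> /(congr1 (@nat_of_ord n)); rewrite /k -ij !val_ordS; do ?case: ifP; lia.
Qed.
End Descent.

(** * Bags of the folded decomposition *)

Section Fold.
Variables (H G : graph) (p : H -> G) (N : set (usep H)).

Lemma tree_act_id (t : model (tree_of N)) : tree_act idfun t = t.
Proof.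
rewrite /tree_act; case: pselect => // nt; apply: sval_inj => /=.
rewrite -[RHS]image_id; apply: eq_imagel => -[A C] _.
by rewrite /map_osep /= !image_id.
Qed.

(** The second alternative is the default branch of [tree_act]. *)
Lemma bag_tree_act f (t : model (tree_of N)) : bijective f ->
  bag (tree_of N) (tree_act f t) `<=` f @` bag (tree_of N) t \/ tree_act f t = t.
Proof.
move=> [g fK gK]; rewrite /tree_act; case: pselect => [nt|_]; [left | by right].
move=> z zt; exists (g z); last exact: gK.
move=> a ta; have [|w aw E] := zt (map_osep f a); first by exists a.
by rewrite -E fK.
Qed.

(** The folded bag comes from one representative of the orbit; a deck transformation moving it to
    [t] commutes with [p], so the image of the bag at [t] is covered as well. *)
Lemma fold_into_cliques : into_cliques (fold_decomposition p (@tree_act H N)) ->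
  forall t : model (tree_of N), clique (p @` bag (tree_of N) t).
Proof.
move=> fc t; pose h : orbit_node p (@tree_act H N) := exist _ (Defs.orbit p (@tree_act H
  N) t) (ex_intro _ t erefl).
have /= fh := fc h; set t' := orbit_repr h in fh.
have E : Defs.orbit p (@tree_act H N) t = Defs.orbit p (@tree_act H N) t' := svalP (cid
  (svalP h)).
have : Defs.orbit p (@tree_act H N) t' t.
  rewrite -E; exists idfun; last exact: tree_act_id.
  by split=> //; split=> //; exists idfun.
move=> [f [[fb _] fp] ft].
have sub : p @` bag (tree_of N) t `<=` p @` bag (tree_of N) t'.
  rewrite -ft; have [s|->] := bag_tree_act t' fb; last by [].
  by move=> _ [z /s [w wt <-] <-]; exists w.
by move=> x y /sub xt /sub yt; exact: fh.
Qed.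
End Fold.

Theorem theorem1 (B : bottleneck_notion) (hB : bottleneck_axioms B)
    (G : graph) (finG : finite_set [set: G]%classic) (connG : connected G)
    (r : nat) (hr : (3 <= r)%N)
    (Gr : graph) (p : Gr -> G) (hp : local_covering r p) :
  locally_chordal r G <-> into_cliques (global_decomposition B p).
Proof.
have conGr : connected Gr by case: hp.
have lf := covering_locally_finite hp finG.
split=> [lc|fc].
  have tc := hole_free_tree_cliques hB lf conGr (cover_hole_free hp hr lc).
  move=> h _ _ [x xt <-] [y yt <-] xy.
  apply: covering_adj (local_covering_covering hp) _ _ _.
  by apply: tc xt yt _ => E; apply: xy; rewrite E.
have [_ Nn Nt] := N_all_nested hB lf conGr.
have [td _] := local_cover_tree hB finG connG (ltnW (ltnW hr)) hp.
apply: (cover_locally_chordal hp hr).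
have tc : into_cliques (bottleneck_tree B Gr).
  by move=> t; apply: (bag_clique hp hr conGr Nn Nt); exact: fold_into_cliques.
exact: (tree_cliques_hole_free Nn Nt tc td).
Qed.
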